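(* Let $\mu$ be a Borel probability measure on $\Omega$. The Borel probability measure $\mathbb{P}_\mu$ is exact dimensional and its dimension is $$ S(\Omega,\mu)=\left(\sum_{p=1}^{p_{d-1}}\widetilde{H}^\mu_{d,p}\right)+\left(\sum_{s=2}^{d-1}\ \sum_{p=p_s+1}^{p_{s-1}}\widetilde{H}^\mu_{s,p}\right)+\sum_{p=p_1+1}^\infty\widetilde{H}^\mu_{1,p}. $$
   Context: Setting. Let $d\ge2$, $q\ge2$ and $m_1\ge\cdots\ge m_d\ge2$ be integers, $\mathcal{A}_k=\{0,\dots,m_k-1\}$, $\mathbb{N}^*=\{1,2,\dots\}$, $\Sigma=(\mathcal{A}_1\times\cdots\times\mathcal{A}_d)^{\mathbb{N}^*}$, with elements $x=(x_i)_{i\ge1}$, $x_i=(x_i^1,\dots,x_i^d)$. Let $\Omega\subset\Sigma$ be nonempty and closed (product topology), $X_\Omega=\{x\in\Sigma:(x_{iq^\ell})_{\ell\ge0}\in\Omega\ \forall i\ge1,\ q\nmid i\}$. For a Borel probability measure $\mu$ on $\Omega$, $\mathbb{P}_\mu$ is the unique Borel probability measure on $\Sigma$ (supported on $X_\Omega$) with $\mathbb{P}_\mu([x_1\cdots x_n])=\prod_{i\le n,\ q\nmid i}\mu([x_ix_{qi}\cdots x_{q^ri}])$, where $q^ri\le n<q^{r+1}i$ and $[w]$ is the set of sequences beginning with $w$. Balls. For $2\le i\le d$ let $\gamma_i=\log(m_i)/\log(m_{i-1})$ and $L_i(n)=\lceil n/\gamma_i\rceil$; $L_1$ is the identity. Let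 $B_n(x)=\{u\in\Sigma:\forall 1\le k\le d,\ \forall 1\le i\le(L_k\circ\cdots\circ L_1)(n),\ u_i^k=x_i^k\}$; $\Sigma$ carries the metric for which these are the closed balls of radius $m_1^{-n}$ (distance $m_1^{-\sup\{n\ge0:u\in B_n(x)\}}$ between $x$ and $u$). A measure $\nu$ is exact dimensional of dimension $D$ if $-\frac1n\log_{m_1}\nu(B_n(x))\to D$ for $\nu$-a.e. $x$. Parameters. For $1\le k\le d-1$ let $p_k$ be the non-negative integer with $q^{p_k}\le\frac{1}{\gamma_d\gamma_{d-1}\cdots\gamma_{k+1}}<q^{p_k+1}$, and $a_k=q^{p_k}\prod_{i=k+1}^d\gamma_i$. For $1\le s\le d-1$ let $\sigma_s$ be the permutation of $\{s,\dots,d-1\}$ for which $(a_{\sigma_s(t)})_{s\le t\le d-1}$ is non-decreasing, ties being ordered by increasing index. (Asymptotically this orders the numbers $\frac{L_k\circ\cdots\circ L_1(n)}{q^{p-p_k-1}}$.) For $1\le s\le d-1$, $s-1\le t\le d-1$, $s\le k\le d-1$ let $p_k^{s,t}=p_k+1$ if $k\in\sigma_s(\{s,\dots,t\})$ and $p_k^{s,t}=p_k$ otherwise. Weights. For $p\ge1$: $\delta_p^{d,d-1}=\frac{(q-1)^2}{q^{p+1}}$; and for $1\le s\le d-1$: $\delta_p^{s,s-1}=\frac{(q\,a_{\sigma_s(s)}-1)(q-1)}{q^{p+1}}$, $\delta_p^{s,t}=\frac{(a_{\sigma_s(t+1)}-a_{\sigma_s(t)})(q-1)}{q^p}$ for $s\le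 t\le d-2$, $\delta_p^{s,d-1}=\frac{(1-a_{\sigma_s(d-1)})(q-1)}{q^p}$. Entropies. For $1\le k\le d$ and $p\ge0$, $\alpha_p^k$ is the partition of $\Omega$ into cylinders of length $p$ along the last $k$ coordinates, i.e. according to the values of $(x_i^l)_{1\le i\le p,\ d-k+1\le l\le d}$ (trivial if $p=0$). $H^\mu_{m_d}(\mathcal{P})=-\sum_{C\in\mathcal{P}}\mu(C)\log_{m_d}\mu(C)$. For $1\le s\le d$, $$\widetilde{H}^\mu_{s,p}=\sum_{t=s-1}^{d-1}\delta_p^{s,t}\,H^\mu_{m_d}\left(\alpha_p^1\lor\alpha^2_{p-p^{s,t}_{d-1}}\lor\alpha^3_{p-p^{s,t}_{d-2}}\lor\cdots\lor\alpha^{d-s+1}_{p-p_s^{s,t}}\right),$$ which for $s=d$ reads $\widetilde{H}^\mu_{d,p}=\delta_p^{d,d-1}H^\mu_{m_d}(\alpha^1_p)$. *)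

(* Defs.v *)
From HB Require Import structures.
From mathcomp Require Import all_boot all_order all_algebra.
From mathcomp Require Import all_classical all_reals all_analysis.

Set Implicit Arguments.
Unset Strict Implicit.
Unset Printing Implicit Defensive.

Import Order.TTheory GRing.Theory Num.Theory.
Import numFieldNormedType.Exports.

Local Open Scope classical_set_scope.
Local Open Scope ring_scope.

(* A_1 x ... x A_d.  The ordinal k : 'I_d stands for the (k+1)-st coordinate,
   so that m keeps its 1-based indexing.  Measurable types are pointed in the
   library, hence (m k.+1).-1.+1, which is m k.+1 as soon as m k.+1 > 0. *)
Definition letter (d : nat) (m : nat -> nat) : Type :=
  {dffun forall k : 'I_d, 'I_(m k.+1).-1.+1}.

HB.instance Definition _ d m := Finite.copy (letter d m)
  {dffun forall k : 'I_d, 'I_(m k.+1).-1.+1}.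
HB.instance Definition _ d m :=
  isPointed.Build (letter d m) [ffun k : 'I_d => ord0 : 'I_(m k.+1).-1.+1].

(* Sequences are indexed by i >= 1 on paper; the i-th term of x : Sigma d m is
   the value of the function x at i.-1, see [term]. *)
Definition Sigma (d : nat) (m : nat -> nat) : Type :=
  prod_topology (fun _ : nat => discrete_topology (letter d m)).

HB.instance Definition _ d m := Pointed.on (Sigma d m).
HB.instance Definition _ d m := Topological.on (Sigma d m).
(* Borel sigma-algebra of the product topology *)
HB.instance Definition _ d m :=
  Measurable.copy (Sigma d m) (g_sigma_algebraType (@open (Sigma d m))).

Definition term d m (x : Sigma d m) (i : nat) : letter d m := x i.-1.

Definition cylinder d m (w : seq (letter d m)) : set (Sigma d m) :=
  [set u | [seq term u i | i <- iota 1 (size w)] = w].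

(* nu is the measure P_mu.  For 0 < i <= n and 1 < q, trunc_log q (n %/ i) is
   the integer r such that q ^ r * i <= n < q ^ r.+1 * i. *)
Definition is_telescopic_product (R : realType) d m (q : nat)
    (mu nu : probability (Sigma d m) R) : Prop :=
  forall (x : Sigma d m) (n : nat),
    nu (cylinder [seq term x i | i <- iota 1 n]) =
    (\prod_(1 <= i < n.+1 | ~~ (q %| i)%N)
      mu (cylinder [seq term x (q ^ l * i)%N
                   | l <- iota 0 (trunc_log q (n %/ i)).+1]))%E.

Section Setting.
Context (R : realType) (d q : nat) (m : nat -> nat).

Definition gamma (i : nat) : R := ln (m i)%:R / ln (m i.-1)%:R.

Definition L (i n : nat) : nat := `|Num.ceil (n%:R / gamma i)|%N.

(* L_k o ... o L_1, with L_1 the identity *)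
Fixpoint Lcomp (k n : nat) : nat :=
  if k is k'.+1 then (if k' is 0 then n else L k (Lcomp k' n)) else n.

Definition Ball (n : nat) (x : Sigma d m) : set (Sigma d m) :=
  [set u | forall (k : 'I_d) (i : nat),
     (1 <= i <= Lcomp k.+1 n)%N -> term u i k = term x i k].

(* lne 0 = -oo, so that the limit is the genuine one *)
Definition exact_dimensional (nu : probability (Sigma d m) R) (D : R) : Prop :=
  {ae nu, forall x,
    (fun n : nat =>
       - (((n%:R)^-1)%:E * (lne (nu (Ball n x)) * ((ln (m 1)%:R)^-1)%:E)))%E
    @ \oo --> D%:E}.

Definition gamma_prod (k : nat) : R := \prod_(k.+1 <= i < d.+1) gamma i.

Definition is_exponents (p : nat -> nat) : Prop :=
  forall k, (1 <= k <= d.-1)%N ->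
    q%:R ^+ p k <= (gamma_prod k)^-1 < q%:R ^+ (p k).+1.

Definition a_ (p : nat -> nat) (k : nat) : R := q%:R ^+ p k * gamma_prod k.

(* sigma s is only meaningful on {s, ..., d-1} *)
Definition is_sorting (p : nat -> nat) (sigma : nat -> nat -> nat) : Prop :=
  forall s, (1 <= s <= d.-1)%N ->
    perm_eq [seq sigma s t | t <- index_iota s d] (index_iota s d) /\
    forall t t', (s <= t)%N -> (t < t')%N -> (t' <= d.-1)%N ->
      a_ p (sigma s t) < a_ p (sigma s t') \/
      (a_ p (sigma s t) = a_ p (sigma s t') /\ (sigma s t < sigma s t')%N).

Section Weights.
Context (p : nat -> nat) (sigma : nat -> nat -> nat).

(* p_k^{s,t} *)
Definition p_st (s t k : nat) : nat :=
  if k \in [seq sigma s u | u <- index_iota s t.+1] then (p k).+1 else p k.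

(* delta_e^{s,t} for s <= d and s - 1 <= t <= d - 1 *)
Definition delta (e s t : nat) : R :=
  if s == d then (q%:R - 1) ^+ 2 / q%:R ^+ e.+1
  else if t == s.-1 then
    (q%:R * a_ p (sigma s s) - 1) * (q%:R - 1) / q%:R ^+ e.+1
  else if t == d.-1 then
    (1 - a_ p (sigma s d.-1)) * (q%:R - 1) / q%:R ^+ e
  else (a_ p (sigma s t.+1) - a_ p (sigma s t)) * (q%:R - 1) / q%:R ^+ e.

End Weights.

End Setting.

Section Entropy.
Context (R : realType) (d q : nat) (m : nat -> nat).
Context (Omega : set (Sigma d m)) (mu : probability (Sigma d m) R).

(* alpha_e^k: the last k coordinates d-k+1, ..., d are the ordinals >= d-k *)
Definition alpha (k e : nat) : set (set (Sigma d m)) :=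
  [set C | exists2 x, Omega x &
     C = [set y | Omega y /\ forall (i : nat) (l : 'I_d),
                    (1 <= i <= e)%N -> (d - k <= l)%N ->
                    term y i l = term x i l]].

Definition join (P Q : set (set (Sigma d m))) : set (set (Sigma d m)) :=
  [set C | C !=set0 /\ exists A B, [/\ P A, Q B & C = A `&` B]].

Definition entropy (P : set (set (Sigma d m))) : R :=
  - \sum_(C \in P) (fine (mu C) * (ln (fine (mu C)) / ln (m d)%:R)).

Context (p : nat -> nat) (sigma : nat -> nat -> nat).

(* The partition attached to (s,t,e).  The factor alpha^j, 2 <= j <= d-s+1,
   goes with k = d+1-j; the unit of the join is the trivial partition. *)
Definition joined_alpha (s t e : nat) : set (set (Sigma d m)) :=
  join (alpha 1 e)
    (\big[join/[set Omega]]_(2 <= j < (d - s)%N.+2)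
        alpha j (e - p_st p sigma s t (d.+1 - j))%N).

Definition Htilde (s e : nat) : R :=
  \sum_(s.-1 <= t < d) delta R d q m p sigma e s t * entropy (joined_alpha s t e).

Definition dimension_formula : \bar R :=
  ((\sum_(1 <= e < (p d.-1).+1) Htilde d e)%:E
   + (\sum_(2 <= s < d) \sum_((p s).+1 <= e < (p s.-1).+1) Htilde s e)%:E
   + \sum_((p 1).+1 <= e <oo) (Htilde 1 e)%:E)%E.

End Entropy.

(* Main.v *)
Require Import Defs.
From mathcomp Require Import all_boot all_order all_algebra.
From mathcomp Require Import all_classical all_reals all_analysis.
From mathcomp Require Import ring lra zify.

(** Write N_k for the length L_k o ... o L_1 (n) of the ball B_n(x) in the
    coordinate k, and N = N_d for the largest of them. The positions split
    into the chains i, q i, q^2 i, ... with i not divisible by q, and under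
    P_mu the chains of a sequence are independent with common law mu
    ([marginal], [chain_law]). A ball fixes, in each coordinate k of the chain
    of i, the first [lev q N_k i] terms ([Ball_chains]), so the information
    -ln P_mu(B_n(x)) is a sum over i <= N of independent terms -ln mu(C_i(x)),
    where C_i(x) is a cell of the partition of Omega by these entries.

    Almost sure convergence. The mean of the i-th term is the entropy of its
    partition, and its second moment is O((log n)^2), because the number of
    cells is at most exponential in the number of levels, which is O(log n)
    ([log_second_moment_le]). Hence the variance of the information is O(n
    (log n)^2), and by Chebyshev's inequality and the Borel-Cantelli lemma the
    information divided by n has the same limit as its mean divided by n along
    n = 1, 2^6, 3^6, ... Since balls decrease with n, this extends to all n
    ([info_cvg_ae]). It remains to find the limit of the mean divided by n.

    The mean. The ratio N_k / N tends to the product of the gamma_i with i >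
    k, that is to a_k / q^(p_k). Group the i by the number e of levels in the
    last coordinate, which means N / q^e < i <= N / q^(e-1). Within such a
    block the number of levels in the coordinate k drops by one when i crosses
    q a_k N / q^e, approximately; so sorting the a_k cuts the block into
    intervals on which the partition is constant, equal to the join attached
    to (s, t) ([joined_alpha_levels]), where s is the first coordinate that
    chains of the block can see. The density of the q-free integers in such an
    interval is the weight delta ([delta_breakpoint]), and the exceptional i
    near the endpoints are negligible; this gives the rate Htilde of the block
    ([rate_block_entropy]). As the block e contains O(n / q^e) chains of
    entropy O(e), the sum over e commutes with the limit ([tannery_geometric],
    [mean_info_rate]), and the result is the formula for the dimension
    ([dimension_formulaE]). *)

Set Implicit Arguments.
Unset Strict Implicit.
Unset Printing Implicit Defensive.

Import Order.TTheory GRing.Theory Num.Theory.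
Import numFieldNormedType.Exports.

Local Open Scope classical_set_scope.
Local Open Scope ring_scope.

(** * Random variables with finitely many values *)

Section FiniteValued.
Context {disp : measure_display} {T : measurableType disp} {R : realType}.
Variable P : probability T R.

Definition measurable_fibers (W : finType) (X : T -> W) : Prop :=
  forall w, measurable [set x | X x = w].

Definition pmf (W : finType) (X : T -> W) (w : W) : R :=
  fine (P [set x | X x = w]).

Definition mean (W : finType) (X : T -> W) (f : W -> R) : R :=
  \sum_w pmf X w * f w.

Lemma pmf_ge0 (W : finType) (X : T -> W) w : 0 <= pmf X w.
Proof. exact/fine_ge0/measure_ge0. Qed.

Lemma preimage_bigsetU (W : finType) (X : T -> W) (A : pred W) :
  [set x | A (X x)] = \big[setU/set0]_(w in A) [set x | X x = w].
Proof.
apply/seteqP; split=> [x /= Ax|x].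
  by rewrite (bigD1 (X x)) //=; left.
by elim/big_ind: _ => // [B C HB HC []|w Aw /= ->].
Qed.

Lemma measurable_preimage (W : finType) (X : T -> W) (A : pred W) :
  measurable_fibers X -> measurable [set x | A (X x)].
Proof.
by move=> mX; rewrite preimage_bigsetU; apply: bigsetU_measurable => w _.
Qed.

Lemma probability_preimage (W : finType) (X : T -> W) (A : pred W) :
  measurable_fibers X ->
  P [set x | A (X x)] = (\sum_(w in A) pmf X w)%:E.
Proof.
move=> mX; rewrite preimage_bigsetU -sumEFin.
rewrite -[in LHS]big_enum -[in RHS]big_enum /=.
have : uniq (enum A) by exact: enum_uniq.
elim: (enum A) => [|w s IH]; first by rewrite !big_nil measure0.
rewrite cons_uniq => /andP[ws us].
rewrite !big_cons measureU ?IH //.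
- congr (_ + _)%E; last exact: IH.
  by rewrite /pmf fineK ?fin_num_measure.
- exact: bigsetU_measurable.
- apply/eqP/negPn/negP => /eqP/eqP/set0P[x [/= Xx]].
  elim: s ws {IH us} => [|w' s IH]; first by rewrite big_nil.
  rewrite inE negb_or big_cons => /andP[ww' ws] [/= Xx'|]; last exact: IH.
  by move: ww'; rewrite -Xx -Xx' eqxx.
Qed.

Lemma pmf_sum1 (W : finType) (X : T -> W) :
  measurable_fibers X -> \sum_w pmf X w = 1.
Proof.
move=> mX; apply: EFin_inj; rewrite -(probability_preimage predT) //=.
by rewrite (_ : [set _ | _] = setT) ?probability_setT //; apply/seteqP; split.
Qed.

Lemma measurable_fibers_comp (V W : finType) (Y : T -> V) (g : V -> W) :
  measurable_fibers Y -> measurable_fibers (g \o Y).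
Proof.
move=> mY w.
have := measurable_preimage [pred v | g v == w] mY.
by congr (measurable _); apply/seteqP; split=> x /= /eqP.
Qed.

Lemma pmf_comp (V W : finType) (Y : T -> V) (g : V -> W) w :
  measurable_fibers Y -> pmf (g \o Y) w = \sum_(v | g v == w) pmf Y v.
Proof.
move=> mY; apply: EFin_inj; rewrite -(probability_preimage [pred v | g v == w])//.
rewrite /pmf fineK ?fin_num_measure//; last exact: measurable_fibers_comp.
by congr (P _); apply/seteqP; split=> x /= /eqP.
Qed.

Lemma mean_comp (V W : finType) (Y : T -> V) (g : V -> W) (f : W -> R) :
  measurable_fibers Y -> mean (g \o Y) f = mean Y (f \o g).
Proof.
move=> mY; rewrite /mean (partition_big g xpredT) //=.
apply: eq_bigr => w _; rewrite pmf_comp // mulr_suml.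
by apply: eq_bigr => v /eqP ->.
Qed.

(** The set is a union of finitely many fibres, each of which is null. *)
Lemma null_fibers (W : finType) (X : T -> W) : measurable_fibers X ->
  P [set x | pmf X (X x) == 0] = 0%E.
Proof.
move=> mX; rewrite (probability_preimage [pred w | pmf X w == 0]) //.
by rewrite big1 // => w /eqP.
Qed.

Lemma measurable_fibers_ffun (I W : finType) (X : I -> T -> W) :
  (forall i, measurable_fibers (X i)) ->
  measurable_fibers (fun x => [ffun i => X i x]).
Proof.
move=> mX y.
rewrite (_ : [set x | _] = \big[setI/setT]_i [set x | X i x = y i]).
  by apply: bigsetI_measurable => i _; exact: mX.
apply/seteqP; split=> [x /= <-|x].
  by elim/big_ind: _ => [|B C HB HC|i _] /=; rewrite ?ffunE.
move=> h; apply/ffunP => i; rewrite ffunE.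
by move: h; rewrite (bigD1 i) //= => -[].
Qed.

(** Pairwise independence suffices, because the variance of a sum only
    involves the covariances of pairs. The computation takes place on the
    finite joint law of the family, where integrals are finite sums. *)
Lemma chebyshev_pairwise (I W : finType) (X : I -> T -> W) (f : I -> W -> R)
    (e : R) :
  0 < e ->
  (forall i, measurable_fibers (X i)) ->
  (forall i j w w', i != j ->
     pmf (fun x => (X i x, X j x)) (w, w') = pmf (X i) w * pmf (X j) w') ->
  (P [set x | (e <= `|\sum_i f i (X i x) - \sum_i mean (X i) (f i)|)%R]
   <= ((\sum_i mean (X i) (fun w => f i w ^+ 2)) / e ^+ 2)%R%:E)%E.
Proof.
move=> e0 mX indep.
pose Y x := [ffun i => X i x].
have mY : measurable_fibers Y by exact: measurable_fibers_ffun.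
pose c i w := f i w - mean (X i) (f i).
have XY i : X i = (fun y : {ffun I -> W} => y i) \o Y.
  by apply/funext => x /=; rewrite ffunE.
have c0 i : mean (X i) (c i) = 0.
  rewrite /mean /c.
  under eq_bigr do rewrite mulrBr.
  by rewrite sumrB -mulr_suml pmf_sum1 // mul1r subrr.
have cc i j : i != j -> mean Y (fun y => c i (y i) * c j (y j)) = 0.
  move=> ij.
  rewrite -(@mean_comp _ _ Y (fun y : {ffun I -> W} => (y i, y j))
     (fun w => c i w.1 * c j w.2)) //.
  rewrite /mean.
  rewrite (_ : _ \o Y = fun x => (X i x, X j x)); last first.
    by apply/funext => x /=; rewrite !ffunE.
  transitivity (\sum_w \sum_w' pmf (fun x => (X i x, X j x)) (w, w') *
      (c i w * c j w')).
    by rewrite pair_bigA /=; apply: eq_bigr => -[].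
  transitivity (\sum_w \sum_w' (pmf (X i) w * c i w) * (pmf (X j) w' * c j w')).
    by apply: eq_bigr => w _; apply: eq_bigr => w' _; rewrite indep //; ring.
  under eq_bigr do rewrite -mulr_sumr.
  by rewrite -mulr_suml -!/(mean _ _) c0 mul0r.
have var : mean Y (fun y => (\sum_i c i (y i)) ^+ 2) <=
    \sum_i mean (X i) (fun w => f i w ^+ 2).
  have -> : mean Y (fun y => (\sum_i c i (y i)) ^+ 2) =
      \sum_i \sum_j mean Y (fun y => c i (y i) * c j (y j)).
    rewrite /mean.
    under [RHS]eq_bigr do rewrite exchange_big /=.
    rewrite [RHS]exchange_big /=.
    apply: eq_bigr => y _.
    rewrite expr2 mulr_suml mulr_sumr.
    apply: eq_bigr => i _.
    by rewrite -mulr_sumr -mulr_sumr.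
  apply: ler_sum => i _; rewrite (bigD1 i) //= [X in _ + X]big1; last first.
    by move=> j ji; apply: cc; rewrite eq_sym.
  rewrite addr0 XY.
  rewrite mean_comp // -subr_ge0.
  have -> : mean Y ((fun w => f i w ^+ 2) \o (fun y : {ffun I -> W} => y i)) -
     mean Y (fun y => c i (y i) * c i (y i)) = mean (X i) (f i) ^+ 2.
    rewrite -(@mean_comp _ _ Y (fun y : {ffun I -> W} => y i)
      (fun w => c i w * c i w)) // -mean_comp // -XY.
    rewrite /mean -sumrB.
    set m := mean (X i) (f i).
    transitivity (\sum_w (2 * m * (pmf (X i) w * f i w) - m ^+ 2 * pmf (X i) w)).
      by apply: eq_bigr => w _; rewrite /c -/m; ring.
    rewrite sumrB -!mulr_sumr pmf_sum1 // -/(mean _ _) -/m; ring.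
  exact: sqr_ge0.
have SE x : \sum_i c i (Y x i) = \sum_i f i (X i x) - \sum_i mean (X i) (f i).
  by rewrite /c sumrB; congr (_ - _); apply: eq_bigr => i _; rewrite ffunE.
have -> : [set x | e <= `|\sum_i f i (X i x) - \sum_i mean (X i) (f i)|] =
   [set x | [pred y : {ffun I -> W} | e <= `|\sum_i c i (y i)|] (Y x)].
  by apply/seteqP; split=> x /=; rewrite SE.
rewrite (probability_preimage _ mY) lee_fin ler_pdivlMr ?exprn_gt0 //.
apply: le_trans var.
rewrite mulr_suml [leLHS]big_mkcond /=; apply: ler_sum => y _.
case: ifP => h; last by rewrite mulr_ge0 ?pmf_ge0 ?sqr_ge0.
rewrite ler_wpM2l ?pmf_ge0 // -[leRHS]real_normK ?num_real //.
by rewrite lerXn2r ?nnegrE ?(ltW e0).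
Qed.

End FiniteValued.

(** The pair formed by f and the indicator of A takes finitely many values,
    and A is a union of its fibres. *)
Lemma fine_partition disp (T : measurableType disp) (R : realType)
    (P : probability T R) (W : finType) (f : T -> W) (A : set T) :
  measurable A -> measurable_fibers f ->
  fine (P A) = \sum_w fine (P (A `&` [set x | f x = w])).
Proof.
move=> mA mf; pose Y x := (f x, `[< A x >]).
have mY : measurable_fibers Y.
  move=> [w b]; rewrite (_ : [set _ | _] =
      [set x | f x = w] `&` (if b then A else ~` A)).
    by apply: measurableI; [exact: mf|case: b => //; exact: measurableC].
  apply/seteqP; split => x /=; case: b => -[<-].
  - by move/asboolP.
  - by move/asboolPn.
  - by move=> Ax; congr pair; apply/asboolP.
  - by move=> Ax; congr pair; apply/asboolPn.
have {1}-> : A = [set x | [pred p : W * bool | p.2] (Y x)].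
  by apply/seteqP; split => x /= /asboolP.
rewrite probability_preimage //=.
transitivity (\sum_w \sum_(b | b == true) pmf P Y (w, b)).
  by rewrite pair_big /=; apply: eq_big => -[w []].
apply: eq_bigr => w _; rewrite big_pred1_eq; congr (fine (P _)).
apply/seteqP; split => x /=; first by case=> <- /asboolP.
by move=> [Ax <-]; congr pair; apply/asboolP.
Qed.

Lemma pmf_out disp (T : measurableType disp) (R : realType)
    (P : probability T R) (W : finType) (X : T -> W) w :
  (forall x, X x <> w) -> pmf P X w = 0.
Proof.
move=> n; rewrite /pmf (_ : [set x | _] = set0) ?measure0 //.
by apply/seteqP; split=> // x /n.
Qed.

(** * Entropy and second moment of the logarithm *)

Section LogBounds.
Context {R : realType}.

Lemma sqr_le_expR (v : R) : 0 <= v -> v ^+ 2 <= 4 * expR v.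
Proof.
move=> v0; have h : 1 + v / 2 <= expR (v / 2) by exact: expR_ge1Dx.
have -> : expR v = expR (v / 2) ^+ 2 by rewrite -expRM_natl; congr expR; field.
have : (1 + v / 2) ^+ 2 <= expR (v / 2) ^+ 2.
  by rewrite lerXn2r ?nnegrE ?expR_ge0 //; lra.
nra.
Qed.

Variables (W : finType) (rho : W -> R).
Hypotheses (rho_ge0 : forall w, 0 <= rho w) (rho_sum1 : \sum_w rho w = 1).

Let rho_le1 w : rho w <= 1.
Proof. by rewrite -rho_sum1 (bigD1 w) //= lerDl sumr_ge0. Qed.

Let cardW_gt0 : 0 < #|W|%:R :> R.
Proof.
rewrite ltr0n lt0n; apply: contra_eqN rho_sum1 => /eqP W0.
rewrite big1 ?(eq_sym 0) ?oner_eq0 // => w _.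
by have := fintype0 w W0.
Qed.

Lemma entropy_ge0 : 0 <= \sum_w - (rho w * ln (rho w)).
Proof.
apply: sumr_ge0 => w _; rewrite oppr_ge0 mulr_ge0_le0 // ln_le0 //.
Qed.

(** This is ln y <= y - 1 for y = 1 / (rho w * #|W|), averaged over w. *)
Lemma entropy_le : \sum_w - (rho w * ln (rho w)) <= ln #|W|%:R.
Proof.
set K : R := #|W|%:R; have K0 : 0 < K := cardW_gt0.
have -> : ln K = \sum_w (rho w * ln K + (K^-1 - rho w)).
  rewrite big_split /= -mulr_suml rho_sum1 mul1r sumrB rho_sum1 sumr_const.
  rewrite -mulr_natl -/K divff ?gt_eqF //; ring.
apply: ler_sum => w _.
have [-> |r0] := eqVneq (rho w) 0.
  by rewrite !mul0r oppr0 add0r addr0 invr_ge0 ltW.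
have {}r0 : 0 < rho w by rewrite lt0r r0 rho_ge0.
have h : ln (rho w * K)^-1 <= (rho w * K)^-1 - 1.
  have := @le_ln1Dx _ ((rho w * K)^-1 - 1).
  rewrite (_ : 1 + _ = (rho w * K)^-1); last by ring.
  by apply; rewrite ltrBDl subrr invr_gt0 mulr_gt0.
have hl : ln (rho w * K)^-1 = - ln (rho w) - ln K.
  by rewrite lnV ?posrE ?mulr_gt0 // lnM ?posrE //; ring.
have hi : rho w * (rho w * K)^-1 = K^-1.
  by rewrite invfM mulrA divff ?mul1r // gt_eqF.
have := ler_wpM2l (ltW r0) h.
rewrite hl [X in _ <= X]mulrBr hi mulr1 => hh; nra.
Qed.

(** The logarithm of an atom exceeds ln #|W| only on atoms smaller than 1 /
    #|W|, and these carry little mass. *)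
Lemma log_second_moment_le :
  \sum_w rho w * (- ln (rho w)) ^+ 2 <= 2 * (ln #|W|%:R) ^+ 2 + 8.
Proof.
set K : R := #|W|%:R; have K0 : 0 < K := cardW_gt0.
have -> : 2 * ln K ^+ 2 + 8 = \sum_w (rho w * (2 * ln K ^+ 2) + 8 / K).
  rewrite big_split /= -mulr_suml rho_sum1 mul1r sumr_const -[_ *+ #|_|]mulr_natl -/K.
  by rewrite [K * _]mulrCA divff ?gt_eqF // mulr1.
apply: ler_sum => w _.
have [-> |r0] := eqVneq (rho w) 0.
  by rewrite !mul0r add0r mulr_ge0 // invr_ge0 ltW.
have {}r0 : 0 < rho w by rewrite lt0r r0 rho_ge0.
have u0 : 0 <= - ln (rho w) by rewrite oppr_ge0 ln_le0.
have k0 : 0 <= ln K by rewrite ln_ge0 // /K ler1n -(ltr0n R).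
have [le|/ltW lt] := leP (- ln (rho w)) (ln K).
  have h8 : 0 <= 8 / K by rewrite mulr_ge0 // invr_ge0 ltW.
  have : (- ln (rho w)) ^+ 2 <= ln K ^+ 2 by rewrite lerXn2r.
  have := sqr_ge0 (ln K).
  nra.
set v := - ln (rho w) - ln K.
have v0 : 0 <= v by rewrite subr_ge0.
have ev : rho w * expR v = K^-1.
  rewrite /v expRD !expRN !lnK ?posrE //.
  by rewrite mulrA divff ?mul1r // gt_eqF.
have := ler_wpM2l (ltW r0) (sqr_le_expR v0).
rewrite [X in _ <= X]mulrCA ev => h.
have -> : - ln (rho w) = ln K + v by rewrite /v; ring.
have : rho w * (ln K + v) ^+ 2 <= rho w * (2 * ln K ^+ 2 + 2 * v ^+ 2).
  rewrite ler_wpM2l ?(ltW r0) //; have := sqr_ge0 (ln K - v); nra.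
by lra.
Qed.

End LogBounds.

(** * Cylinders and chains *)

Lemma qfree_gt0 q i : ~~ (q %| i)%N -> (0 < i)%N.
Proof. by case: i => //; rewrite dvdn0. Qed.

Section Cylinders.
Context {d : nat} {m : nat -> nat}.
Implicit Types (G : nat -> 'I_d -> bool) (x y u : Sigma d m).

(** All cylinders are encoded by the set G of their constrained entries
    (position, coordinate), so that balls, cylinders and cells of the
    partitions alpha are treated alike. Positions start at 0. *)
Definition agree G x y : Prop := forall i k, G i k -> y i k = x i k.

Lemma agree_trans G x y u : agree G x y -> agree G y u -> agree G x u.
Proof. by move=> h h' i k g; rewrite h' ?h. Qed.

Lemma eq_agree G G' x y : (forall i k, G i k = G' i k) ->
  agree G x y <-> agree G' x y.
Proof. by move=> e; split=> h i k g; apply: h; [rewrite e|rewrite -e]. Qed.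

Lemma measurable_entry i (k : 'I_d) (a : 'I_(m k.+1).-1.+1) :
  measurable [set y : Sigma d m | y i k = a].
Proof.
apply: sub_gen_smallest.
have pc : continuous (fun y : Sigma d m => y i : discrete_topology (letter d m)).
  exact: (@proj_continuous nat (fun=> discrete_topology (letter d m)) i).
exact: ((continuousP _).1 pc [set b : letter d m | b k = a] (discrete_open _)).
Qed.

Lemma measurable_agree_at (f : nat -> nat) G y :
  measurable [set x : Sigma d m | agree G y (fun l => x (f l))].
Proof.
rewrite (_ : [set x | _] = \bigcap_l \big[setI/setT]_(k < d)
    [set x : Sigma d m | G l k -> x (f l) k = y l k]).
  apply: bigcapT_measurable => l; apply: bigsetI_measurable => k _.
  case: (G l k); last first.
    by rewrite (_ : [set _ | _] = setT) //; apply/seteqP; split.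
  rewrite (_ : [set _ | _] = [set x : Sigma d m | x (f l) k = y l k]).
    exact: measurable_entry.
  by apply/seteqP; split => x /= h //; apply: h.
apply/seteqP; split => [x h l _|x h l k].
  elim/big_ind: _ => //= k _; exact: h.
by have := h l I; rewrite (bigD1 k) //= => -[].
Qed.

Lemma measurable_agree G x : measurable [set y | agree G x y].
Proof. exact: (measurable_agree_at id). Qed.

(** Overwriting the entries outside G by a constant turns agreement on G into
    equality of words taken from a finite type. *)
Definition trunc T G x : {ffun 'I_T -> letter d m} :=
  [ffun i : 'I_T => [ffun k : 'I_d =>
    (if G i k then x i k else ord0) : 'I_(m k.+1).-1.+1] : letter d m].

Lemma trunc_agree T G x y : (forall i k, G i k -> (i < T)%N) ->
  trunc T G y = trunc T G x <-> agree G x y.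
Proof.
move=> GT; split=> [e i k g|h].
  have := congr1 (fun f : {ffun 'I_T -> letter d m} => f (Ordinal (GT _ _ g)) k) e.
  by rewrite !ffunE /= g.
apply/ffunP => i; apply/ffunP => k; rewrite !ffunE.
by case: ifP => // /h.
Qed.

Lemma measurable_trunc_at (f : nat -> nat) T G :
  (forall i k, G i k -> (i < T)%N) ->
  measurable_fibers (fun x : Sigma d m => trunc T G (fun l => x (f l))).
Proof.
move=> GT w.
have [[x <-]|n] := pselect (exists x, trunc T G x = w).
  rewrite (_ : [set _ | _] = [set y : Sigma d m | agree G x (fun l => y (f l))]).
    exact: measurable_agree_at.
  by apply/seteqP; split => y /(trunc_agree _ _ GT).
rewrite (_ : [set _ | _] = set0) //.
by apply/seteqP; split => y //= h; apply: n; exists (fun l => y (f l)).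
Qed.

Lemma measurable_trunc T G : (forall i k, G i k -> (i < T)%N) ->
  measurable_fibers (trunc T G).
Proof. exact: (measurable_trunc_at id). Qed.

(** The subsequence x_i, x_(qi), x_(q^2 i), ... ; the predecessor is there
    because positions start at 0. *)
Definition chain (q i : nat) x : Sigma d m := fun l => x (q ^ l * i).-1.

Definition pull (q i : nat) G : nat -> 'I_d -> bool :=
  fun l k => G (q ^ l * i).-1 k.

(** The dependent update is forced by the alphabets, which vary with the
    coordinate. *)
Definition upd x j (k : 'I_d) (a : 'I_(m k.+1).-1.+1) : Sigma d m :=
  fun i => if i == j then [ffun k' => eqtype.dfwith (x i) a k'] else x i.

Definition add_entry G j (k : 'I_d) : nat -> 'I_d -> bool :=
  fun i k' => G i k' || ((i == j) && (k' == k)).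

Lemma upd_in x j k a : @upd x j k a j k = a.
Proof. by rewrite /upd eqxx ffunE dfwith_in. Qed.

Lemma upd_out x j k a i k' : (i != j) || (k' != k) ->
  @upd x j k a i k' = x i k'.
Proof.
rewrite /upd; case: eqP => //= _ kk; rewrite ffunE dfwith_out //.
by rewrite eq_sym.
Qed.

Lemma agree_upd G x j (k : 'I_d) (a : 'I_(m k.+1).-1.+1) : ~~ G j k ->
  [set y | agree (add_entry G j k) (upd x j a) y] =
  [set y | agree G x y] `&` [set y : Sigma d m | y j k = a].
Proof.
move=> nG; apply/seteqP; split=> [y h|y [h ya] i k'].
  split=> [i k' g|]; last by rewrite /= h ?upd_in // /add_entry !eqxx orbT.
  rewrite h ?upd_out //; last by rewrite /add_entry g.
  rewrite -negb_and; apply: contra nG => /andP[/eqP <- /eqP <-] //.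
rewrite /add_entry; have [/andP[/eqP -> /eqP ->]|] := boolP ((_ == _) && _).
  by rewrite upd_in.
by rewrite orbF negb_and => e g; rewrite upd_out //; exact: h.
Qed.

Lemma chain_upd q i l x j (k : 'I_d) (a : 'I_(m k.+1).-1.+1) : (q ^ l * i).-1 = j ->
  (forall l', (q ^ l' * i).-1 = j -> l' = l) ->
  chain q i (upd x j a) = upd (chain q i x) l a.
Proof.
move=> e inj; apply/funext => l'; rewrite /chain /upd.
have [->|ne] := eqVneq l' l; first by rewrite e eqxx.
by case: eqP => // /inj; move/eqP: ne.
Qed.

(** With the next lemma: every position lies on exactly one chain. *)
Lemma qfree_factor q n : (1 < q)%N -> (0 < n)%N ->
  exists l i, [/\ (q ^ l * i)%N = n, ~~ (q %| i)%N & (0 < i <= n)%N].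
Proof.
move=> q1; elim/ltn_ind: n => n IH n0.
have [/dvdnP[c nE]|nd] := boolP (q %| n)%N; last first.
  by exists 0%N, n; rewrite expn0 mul1n nd n0 leqnn.
have c0 : (0 < c)%N by move: n0; rewrite nE muln_gt0 => /andP[].
have [|l [i [e nd /andP[i0 ic]]]] := IH c _ c0; first by rewrite nE ltn_Pmulr.
exists l.+1, i; split=> //; first by rewrite nE expnS -mulnA e mulnC.
by rewrite i0 (leq_trans ic) // nE leq_pmulr // ltnW.
Qed.

Lemma qfree_factor_inj q l i l' i' : (1 < q)%N ->
  ~~ (q %| i)%N -> ~~ (q %| i')%N -> (q ^ l * i = q ^ l' * i')%N ->
  l = l' /\ i = i'.
Proof.
move=> q1; wlog ll : l i l' i' / (l <= l')%N.
  move=> H di di' e; have [ll|/ltnW ll] := leqP l l'; first exact: H.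
  by have [-> ->] := H _ _ _ _ ll di' di (esym e).
move=> di _ e.
have {e} e : i = (q ^ (l' - l) * i')%N.
  apply/eqP; rewrite -(@eqn_pmul2l (q ^ l)) ?expn_gt0 ?(ltnW q1) //.
  by rewrite mulnA -expnD subnKC // e.
case: (posnP (l' - l)) => [z|p].
  by split; [apply/eqP; rewrite eqn_leq ll -subn_eq0 z|rewrite e z expn0 mul1n].
by move: di; rewrite e -(prednK p) expnS -mulnA dvdn_mulr.
Qed.

End Cylinders.

(** * The chains under the telescopic product *)

Lemma pmf_trunc (R : realType) d m (nu : probability (Sigma d m) R) T
    (F : nat -> 'I_d -> bool) y : (forall l k, F l k -> (l < T)%N) ->
  pmf nu (trunc T F) (trunc T F y) = fine (nu [set u | agree F y u]).
Proof.
move=> FT; rewrite /pmf; congr (fine (nu _)).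
by apply/seteqP; split=> u /(trunc_agree _ _ FT).
Qed.

Lemma leq_trunc_log_div q n i l : (1 < q)%N -> (0 < i <= n)%N ->
  (l < (trunc_log q (n %/ i)).+1)%N = (q ^ l * i <= n)%N.
Proof.
move=> q1 /andP[i0 le_in]; rewrite ltnS -leq_divRL //.
have n0 : (0 < n %/ i)%N by rewrite divn_gt0.
apply/idP/idP => [le|]; last exact: trunc_log_max.
by apply: leq_trans (trunc_logP q1 n0); rewrite leq_pexp2l // ltnW.
Qed.

Section TelescopicProduct.
Context {R : realType} {d q : nat} {m : nat -> nat}.
Hypothesis q_gt1 : (1 < q)%N.
Variables (mu Pmu : probability (Sigma d m) R).
Hypothesis hPmu : is_telescopic_product q mu Pmu.
Implicit Types (G : nat -> 'I_d -> bool) (x y u : Sigma d m).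

Lemma cylinder_agree n (f : nat -> nat) x :
  (forall l, (l < n)%N -> f l.+1 = l) ->
  cylinder [seq x (f i) | i <- iota 1 n] =
  [set u : Sigma d m | agree (fun i _ => (i < n)%N) (x \o f \o succn) u].
Proof.
move=> fE; rewrite /cylinder size_map size_iota.
apply/seteqP; split => u /=.
  move=> /eq_in_map e i k lt_in; have /= <- // := e i.+1.
  by rewrite mem_iota add1n !ltnS lt_in.
move=> h; apply/eq_in_map => -[|i]; rewrite mem_iota //= add1n ltnS => lt_in.
by rewrite /term /=; apply/ffunP => k; rewrite (h i k).
Qed.

Lemma full_marginal n x :
  fine (Pmu [set u | agree (fun i _ => (i < n)%N) x u]) =
  \prod_(i < n.+1 | ~~ (q %| i)%N)
    fine (mu [set y | agree (pull q i (fun i _ => (i < n)%N)) (chain q i x) y]).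
Proof.
have := hPmu x n.
rewrite (_ : cylinder _ = [set u | agree (fun i _ => (i < n)%N) x u]); last first.
  by rewrite (@cylinder_agree n predn).
move=> ->.
rewrite big_nat_cond big_mkcond /= -(big_mkord (fun i => ~~ (q %| i)%N)
  (fun i => fine (mu [set y |
     agree (pull q i (fun i _ => (i < n)%N)) (chain q i x) y]))).
rewrite [in RHS]big_ltn_cond // dvdn0 /= -big_mkcond /= -big_nat_cond.
rewrite [in LHS]big_nat_cond [in RHS]big_nat_cond.
transitivity (fine (\prod_(1 <= i < n.+1 | (1 <= i < n.+1)%N && ~~ (q %| i)%N)
  (fine (mu [set y | agree (pull q i (fun i _ => (i < n)%N)) (chain q i x) y]))%:E)).
  congr fine; apply: eq_bigr => i /andP[/andP[i0 ilt] _].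
  rewrite fineK ?fin_num_measure //; last exact: measurable_agree.
  congr (mu _).
  have E : [seq term x (q ^ l * i)%N | l <- iota 0 (trunc_log q (n %/ i)).+1] =
     [seq chain q i x l.-1 | l <- iota 1 (trunc_log q (n %/ i)).+1].
    by rewrite (iotaDl 1 0) -map_comp.
  apply: etrans (congr1 (@cylinder d m) E) _.
  rewrite (@cylinder_agree _ predn) //.
  have key l : (l < (trunc_log q (n %/ i)).+1)%N = ((q ^ l * i).-1 < n)%N.
    rewrite leq_trunc_log_div ?i0 //.
    have : (0 < q ^ l * i)%N by rewrite muln_gt0 expn_gt0 (ltnW q_gt1).
    by case: (q ^ l * i)%N.
  by apply/seteqP; split => y /=; apply eq_agree => l k; rewrite key.
apply: EFin_inj; rewrite -prodEFin fineK // prodEFin //.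
Qed.


(** The set G is thinned out from the full rectangle one entry at a time.
    Summing over the values of the entry (j, k) removes it from the left-hand
    side; on the right-hand side only the factor of the chain through j
    depends on that entry, and the same sum removes it there. *)
Lemma marginal n G x : (forall j k, G j k -> (j < n)%N) ->
  fine (Pmu [set u | agree G x u]) =
  \prod_(i < n.+1 | ~~ (q %| i)%N)
    fine (mu [set y | agree (pull q i G) (chain q i x) y]).
Proof.
move: {2}#|_| (leqnn #|[pred p : 'I_n * 'I_d | ~~ G p.1 p.2]|) => c.
elim: c G x => [|c IH] G x cG Gn.
  have GE j k : G j k = (j < n)%N.
    apply/idP/idP => [/Gn //|jn]; apply/negPn/negP => nG.
    move: cG; rewrite leqn0 => /eqP/card0_eq/(_ (Ordinal jn, k)).
    by rewrite !inE /= nG.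
  rewrite (_ : [set u | _] = [set u | agree (fun i _ => (i < n)%N) x u]).
    rewrite full_marginal; apply: eq_bigr => i _; congr (fine (mu _)).
    by apply/seteqP; split => y; apply eq_agree => l k; rewrite /pull GE.
  by apply/seteqP; split => y; apply eq_agree => l k; rewrite GE.
have [h0|] := posnP #|[pred p : 'I_n * 'I_d | ~~ G p.1 p.2]|.
  by apply: IH => //; rewrite h0.
move=> /card_gt0P[[j k]]; rewrite inE /= => nG.
have G'n a b : add_entry G j k a b -> (a < n)%N.
  by move=> /orP[/Gn //|/andP[/eqP -> _]]; exact: ltn_ord.
have cG' : (#|[pred p : 'I_n * 'I_d | ~~ add_entry G j k p.1 p.2]| <= c)%N.
  rewrite -ltnS; apply: leq_trans cG; apply: proper_card; apply/properP; split.
    by apply/fintype.subsetP => -[a b]; rewrite !inE negb_or => /andP[].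
  by exists (j, k); rewrite !inE //= negbK /add_entry !eqxx orbT.
have [l0 [i0 [jE qi0 /andP[i0p i0j]]]] := qfree_factor q_gt1 (ltn0Sn j).
have i0n : (i0 < n.+1)%N by rewrite ltnS (leq_trans i0j).
have posj l : ((q ^ l * i0).-1 == j) = (l == l0).
  apply/eqP/eqP => [e|->]; last by rewrite jE.
  have : (q ^ l * i0 = q ^ l0 * i0)%N.
    by rewrite jE -e prednK // muln_gt0 expn_gt0 (ltnW q_gt1).
  by case/(qfree_factor_inj q_gt1 qi0 qi0).
have mval i : measurable_fibers (fun u : Sigma d m => u i k).
  by move=> a; exact: measurable_entry.
rewrite (fine_partition Pmu (measurable_agree _ _) (mval j)).
rewrite (eq_bigr (fun a => \prod_(i < n.+1 | ~~ (q %| i)%N)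
    fine (mu [set y | agree (pull q i (add_entry G j k))
                        (chain q i (upd x j a)) y]))); last first.
  by move=> a _; rewrite -IH // agree_upd.
rewrite (bigD1 (Ordinal i0n)) //=.
rewrite (fine_partition mu (measurable_agree _ _) (mval l0)) mulr_suml.
apply: eq_bigr => a _; rewrite (bigD1 (Ordinal i0n)) //=; congr (_ * _).
  congr (fine (mu _)).
  apply: etrans _ (agree_upd _ _ _); last by rewrite /pull jE.
  rewrite (@chain_upd _ _ _ _ l0) //; first last.
  - by move=> l /eqP; rewrite posj => /eqP.
  - by rewrite jE.
  apply/seteqP; split => y; apply eq_agree => l k'.
    by rewrite /pull /add_entry posj.
  by rewrite /pull /add_entry posj.
apply: eq_bigr => i /andP[qi ii0]; congr (fine (mu _)).
have ne l : ((q ^ l * i).-1 == j) = false.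
  apply/negP => /eqP e; move/negP: ii0; apply; apply/eqP/val_inj => /=.
  have ip := qfree_gt0 qi.
  have : (q ^ l * i = q ^ l0 * i0)%N.
    by rewrite jE -e prednK // muln_gt0 expn_gt0 (ltnW q_gt1).
  by case/(qfree_factor_inj q_gt1 qi qi0).
have ce l k' : chain q i (upd x j a) l k' = chain q i x l k'.
  by rewrite /chain upd_out // ne.
apply/seteqP; split => y h l k' g; rewrite (h l k') ?ce //.
all: by move: g; rewrite /pull /add_entry ne orbF.
Qed.


(** The chains are disjoint and cover all positions, so they can be prescribed
    independently of each other. *)
Lemma chains_surj (Y : nat -> Sigma d m) :
  exists x, forall i, ~~ (q %| i)%N -> chain q i x = Y i.
Proof.
have fact j : exists li : nat * nat,
    (q ^ li.1 * li.2)%N = j.+1 /\ ~~ (q %| li.2)%N.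
  by have [l [i [e qi _]]] := qfree_factor q_gt1 (ltn0Sn j); exists (l, i).
have [f fE] := choice fact.
exists (fun j => Y (f j).2 (f j).1) => i qi.
apply/funext => l; rewrite /chain.
have [e qf] := fE (q ^ l * i).-1.
have ip := qfree_gt0 qi.
move: e; rewrite prednK ?muln_gt0 ?expn_gt0 ?(ltnW q_gt1) //.
by case/(qfree_factor_inj q_gt1 qf qi) => -> ->.
Qed.

(** The chains are independent with common law mu. Taking F i empty for the
    chains that do not matter, this gives the law of one chain, of a pair of
    chains, and of a ball. *)
Lemma chain_law N (F : nat -> nat -> 'I_d -> bool) T (Y : nat -> Sigma d m) :
  (forall i l k, F i l k -> (l < T)%N) ->
  fine (Pmu [set u | forall i, (i <= N)%N -> ~~ (q %| i)%N ->
                       agree (F i) (Y i) (chain q i u)]) =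
  \prod_(i < N.+1 | ~~ (q %| i)%N) fine (mu [set y | agree (F i) (Y i) y]).
Proof.
move=> FT.
have [x xY] := chains_surj Y.
have fact j : exists li : nat * nat,
    (q ^ li.1 * li.2)%N = j.+1 /\ ~~ (q %| li.2)%N.
  by have [l [i [e qi _]]] := qfree_factor q_gt1 (ltn0Sn j); exists (l, i).
have [f fE] := choice fact.
have fK l i : ~~ (q %| i)%N -> f (q ^ l * i).-1 = (l, i).
  move=> qi; have [e qf] := fE (q ^ l * i).-1.
  have ip := qfree_gt0 qi.
  move: e; rewrite prednK ?muln_gt0 ?expn_gt0 ?(ltnW q_gt1) //.
  by case/(qfree_factor_inj q_gt1 qf qi); case: (f _) => ? ? /= -> ->.
pose G j k := ((f j).2 <= N)%N && F (f j).2 (f j).1 k.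
(* Constraints reach the level T - 1 of chains that start at most at N. *)
have Gn j k : G j k -> (j < q ^ T * N)%N.
  move=> /andP[le /FT lt]; have [<- _] := fE j.
  by rewrite leq_mul // leq_pexp2l ?(ltnW q_gt1) // ltnW.
have pullG i l k : ~~ (q %| i)%N -> pull q i G l k = (i <= N)%N && F i l k.
  by move=> qi; rewrite /pull /G fK.
rewrite (_ : [set u | _] = [set u | agree G x u]); last first.
  apply/seteqP; split => u h.
    move=> j k /andP[le g]; have [e qf] := fE j.
    have := h _ le qf _ _ g; rewrite -xY // /chain.
    by rewrite e.
  move=> i le qi l k g; rewrite -xY // /chain; apply: h.
  by rewrite -[G _ _]/(pull q i G l k) pullG // le.
rewrite (marginal _ Gn).
set n := (q ^ T * N)%N.
have Nn : (N.+1 <= n.+1)%N by rewrite ltnS leq_pmull // expn_gt0 (ltnW q_gt1).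
rewrite (big_ord_widen_cond _ (fun i => ~~ (q %| i)%N)
  (fun i => fine (mu [set y | agree (F i) (Y i) y])) Nn).
rewrite [RHS]big_mkcondr /=; apply: eq_bigr => i qi.
rewrite xY //; case: ifP => [le|gt].
  congr (fine (mu _)).
  by apply/seteqP; split => y; apply eq_agree => l k; rewrite pullG // -ltnS le.
rewrite (_ : [set y | _] = setT) ?probability_setT //.
apply/seteqP; split => y // _ l k; rewrite pullG //.
by rewrite -ltnS gt.
Qed.

Lemma chain_pmf T (F : nat -> 'I_d -> bool) i w :
  (forall l k, F l k -> (l < T)%N) -> ~~ (q %| i)%N ->
  pmf Pmu (trunc T F \o chain q i) w = pmf mu (trunc T F) w.
Proof.
move=> FT qi.
have [[y <-]|n] := pselect (exists y, trunc T F y = w); last first.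
  by rewrite !pmf_out // => x h; apply: n; [exists x|exists (chain q i x)].
rewrite pmf_trunc //.
pose FF j : nat -> 'I_d -> bool := if j == i then F else fun _ _ => false.
transitivity (fine (Pmu [set u | forall j, (j <= i)%N -> ~~ (q %| j)%N ->
   agree (FF j) y (chain q j u)])).
  congr (fine (Pmu _)); apply/seteqP; split => u.
    by move=> /(trunc_agree _ _ FT) h j _ _; rewrite /FF; case: eqP => [->|].
  move=> /(_ i (leqnn _) qi); rewrite /FF eqxx => h.
  exact/(trunc_agree _ _ FT).
rewrite (@chain_law i FF T (fun=> y)); last first.
  by move=> j l k; rewrite /FF; case: ifP => // _; exact: FT.
rewrite (bigD1 ord_max) //= {1}/FF eqxx big1 ?mulr1 //.
move=> j /andP[_ ji]; rewrite /FF.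
rewrite (_ : (j == i :> nat) = false); last by apply: negbTE; exact: ji.
by rewrite (_ : [set y0 | _] = setT) ?probability_setT //; apply/seteqP; split.
Qed.

Lemma chain_pmf_pair T (F F' : nat -> 'I_d -> bool) i i' w w' :
  (forall l k, F l k -> (l < T)%N) -> (forall l k, F' l k -> (l < T)%N) ->
  ~~ (q %| i)%N -> ~~ (q %| i')%N -> i != i' ->
  pmf Pmu (fun x => (trunc T F (chain q i x), trunc T F' (chain q i' x))) (w, w')
  = pmf mu (trunc T F) w * pmf mu (trunc T F') w'.
Proof.
move=> FT FT' qi qi' ii'.
have [[y yw]|n] := pselect (exists y, trunc T F y = w); last first.
  rewrite [pmf mu (trunc T F) w]pmf_out => [|x h]; last by apply: n; exists x.
  rewrite mul0r pmf_out // => x [h _]; by apply: n; exists (chain q i x).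
have [[y' yw']|n] := pselect (exists y, trunc T F' y = w'); last first.
  rewrite [pmf mu (trunc T F') w']pmf_out => [|x h]; last by apply: n; exists x.
  rewrite mulr0 pmf_out // => x [_ h]; by apply: n; exists (chain q i' x).
rewrite -yw -yw' !pmf_trunc //.
pose FF j : nat -> 'I_d -> bool :=
  if j == i then F else if j == i' then F' else fun _ _ => false.
pose Y j := if j == i then y else y'.
transitivity (fine (Pmu [set u | forall j, (j <= maxn i i')%N -> ~~ (q %| j)%N ->
   agree (FF j) (Y j) (chain q j u)])).
  congr (fine (Pmu _)); apply/seteqP; split => u.
    move=> [/(trunc_agree _ _ FT) h /(trunc_agree _ _ FT') h'] j _ _.
    by rewrite /FF /Y; case: eqP => [->//|_]; case: eqP => [->|].
  move=> h; congr pair.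
    apply/(trunc_agree _ _ FT).
    by move: (h i (leq_maxl _ _) qi); rewrite /FF /Y eqxx.
  apply/(trunc_agree _ _ FT').
  move: (h i' (leq_maxr _ _) qi').
  by rewrite /FF /Y eq_sym (negbTE ii') eqxx.
rewrite (@chain_law _ FF T Y); last first.
  by move=> j l k; rewrite /FF; case: ifP => [_ /FT|_] //; case: ifP => [_ /FT'|].
have lti : (i < (maxn i i').+1)%N by rewrite ltnS leq_maxl.
have lti' : (i' < (maxn i i').+1)%N by rewrite ltnS leq_maxr.
rewrite (bigD1 (Ordinal lti)) // (bigD1 (Ordinal lti')) /=; last first.
  by rewrite qi' /= -val_eqE /= eq_sym.
rewrite big1 ?mulr1; last first.
  move=> j /andP[/andP[_ ji] ji']; rewrite /FF.
  move: ji ji'; rewrite -!val_eqE /= => /negbTE -> /negbTE ->.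
  by rewrite (_ : [set y0 | _] = setT) ?probability_setT //; apply/seteqP; split.
by rewrite /FF /Y eqxx [i' == i]eq_sym (negbTE ii') eqxx.
Qed.

End TelescopicProduct.

(** * Partitions into cylinders *)

Section Partitions.
Context {R : realType} {d : nat} {m : nat -> nat}.
Variable Omega : set (Sigma d m).
Implicit Types (G : nat -> 'I_d -> bool) (x y : Sigma d m).

(** The partition of Omega into the classes of agreement on G. Each alpha is
    of this form, and joins amount to unions of the sets G. *)
Definition classes G : set (set (Sigma d m)) :=
  [set C | exists2 x, Omega x & C = [set y | Omega y /\ agree G x y]].

Definition levels (r : nat -> nat) : nat -> 'I_d -> bool :=
  fun l k => (l < r k.+1)%N.

Lemma eq_classes G G' : (forall l k, G l k = G' l k) -> classes G = classes G'.
Proof. by move=> e; congr classes; apply/funext => l; apply/funext => k. Qed.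

Lemma classes_trivial : Omega !=set0 ->
  classes (fun _ _ => false) = [set Omega].
Proof.
move=> [x Ox]; apply/seteqP; split=> [C [y _ ->]|C ->].
  by apply/seteqP; split=> [z []|].
by exists x => //; apply/seteqP; split=> [y Oy|y []].
Qed.

Lemma join_classes G G' :
  join (classes G) (classes G') = classes (fun l k => G l k || G' l k).
Proof.
apply/seteqP; split=> [C [[z Cz] [A [B [[x Ox AE] [x' Ox' BE] CE]]]]|C [x Ox ->]].
  have [Oz xz x'z] : [/\ Omega z, agree G x z & agree G' x' z].
    by move: Cz; rewrite CE AE BE => -[[] ? ? []].
  exists z => //; rewrite CE AE BE; apply/seteqP; split=> y.
    by move=> [[Oy xy] [_ x'y]]; split=> // l k /orP[g|g];
      [rewrite xy // xz|rewrite x'y // x'z].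
  move=> [Oy zy]; split; split=> //.
    by apply: (agree_trans xz) => l k g; apply: zy; rewrite g.
  by apply: (agree_trans x'z) => l k g; apply: zy; rewrite g orbT.
split; first by exists x.
exists [set y | Omega y /\ agree G x y], [set y | Omega y /\ agree G' x y].
split; [by exists x|by exists x|].
apply/seteqP; split=> y.
  by move=> [Oy xy]; split; split=> // l k g; apply: xy; rewrite g ?orbT.
by move=> [[Oy xy] [_ x'y]]; split=> // l k /orP[/xy|/x'y].
Qed.

Lemma alpha_classes k e :
  alpha Omega k e = classes (fun l j => (l < e)%N && (d - k <= j)%N).
Proof.
have h x : [set y | Omega y /\ forall (i : nat) (l : 'I_d),
                    (1 <= i <= e)%N -> (d - k <= l)%N -> term y i l = term x i l] =
  [set y | Omega y /\ agree (fun l j => (l < e)%N && (d - k <= j)%N) x y].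
  apply/seteqP; split=> y [Oy xy]; split=> //.
    by move=> l j /andP[le kj]; exact: (xy l.+1).
  move=> [//|i] l /andP[_ le] kl; apply: xy; exact/andP.
by apply/seteqP; split=> C [x Ox ->]; exists x => //; rewrite h.
Qed.

Lemma big_join_alpha (g : nat -> nat) (s : seq nat) : Omega !=set0 ->
  \big[@join d m/[set Omega]]_(j <- s) alpha Omega j (g j) =
  classes (fun l k => has (fun j => (l < g j)%N && (d - j <= k)%N) s).
Proof.
move=> O0; elim: s => [|j s IH]; first by rewrite big_nil -classes_trivial.
by rewrite big_cons IH alpha_classes join_classes.
Qed.

(** A coordinate k is constrained by the factors of the join that go with the
    coordinates k' <= k. Since p_st is nonincreasing in k, the longest of
    these cylinders is the one that goes with k itself. *)
Lemma joined_alpha_levels (p : nat -> nat) sigma s t e (r : nat -> nat) :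
  Omega !=set0 -> (1 <= s <= d)%N ->
  (forall k k', (s <= k <= k')%N -> (k' < d)%N ->
     (p_st p sigma s t k' <= p_st p sigma s t k)%N) ->
  r d = e ->
  (forall k, (s <= k < d)%N -> r k = (e - p_st p sigma s t k)%N) ->
  (forall k, (k < s)%N -> (k < d)%N -> r k = 0%N) ->
  joined_alpha Omega p sigma s t e = classes (levels r).
Proof.
move=> O0 /andP[s1 sd] mono rd rs r0.
rewrite /joined_alpha alpha_classes.
rewrite (big_join_alpha (fun j => (e - p_st p sigma s t (d.+1 - j))%N)) //.
rewrite join_classes; apply: eq_classes => l k; rewrite /levels.
have kd := ltn_ord k.
apply/idP/idP.
  case/orP => [/andP[le kd']|/hasP[j]].
    by rewrite (_ : k.+1 = d) ?rd //; lia.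
  rewrite mem_index_iota => /andP[j2 jd] /andP[le kj].
  have [kE|kE] := eqVneq k.+1 d; first by rewrite kE rd; lia.
  have skd : (s <= k.+1 < d)%N by lia.
  rewrite rs //; apply: leq_trans le _.
  by apply: leq_sub2l; apply: mono; lia.
move=> le; have [kE|kE] := eqVneq k.+1 d.
  by move: le; rewrite kE rd => ->; apply/orP; left; lia.
have [sk|ks] := leqP s k.+1; last by move: le; rewrite r0 //; lia.
apply/orP; right; apply/hasP; exists (d - k)%N; first by rewrite mem_index_iota; lia.
rewrite (_ : (d.+1 - (d - k) = k.+1)%N); last by lia.
rewrite -rs; last by lia.
by rewrite le; lia.
Qed.

Variable mu : probability (Sigma d m) R.
Hypotheses (closed_Omega : closed Omega) (mu_Omega : mu Omega = 1%E).

Let measurable_Omega : measurable Omega.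
Proof.
rewrite -(setCK Omega); apply: measurableC; apply: sub_gen_smallest.
exact: closed_openC.
Qed.

Let mu_setI (A : set (Sigma d m)) : measurable A -> mu (Omega `&` A) = mu A.
Proof.
move=> mA; have O'0 : mu (~` Omega) = 0%E.
  by rewrite probability_setC // mu_Omega subee.
have mAO : measurable (A `&` Omega) by exact: measurableI.
have mAO' : measurable (A `&` ~` Omega).
  by apply: measurableI => //; exact: measurableC.
have dis : (A `&` Omega) `&` (A `&` ~` Omega) = set0.
  by rewrite setIACA setICr setI0.
have le : (mu (A `&` ~` Omega) <= mu (~` Omega))%E.
  by apply: le_measure; rewrite ?inE //; exact: measurableC.
have null : mu (A `&` ~` Omega) = 0%E.
  by apply/eqP; rewrite -measure_le0 (le_trans le) ?O'0.
rewrite -[in RHS](setIT A) -(setUv Omega) setIUr measureU //.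
rewrite [X in (_ + X)%E](_ : _ = 0%E); first by rewrite adde0 setIC.
exact: null.
Qed.

(** Words whose cylinder misses Omega are null and contribute nothing, so the
    sum may range over all truncated words. *)
Lemma entropy_classes T G : (1 < m d)%N -> (forall l k, G l k -> (l < T)%N) ->
  ln (m d)%:R * entropy mu (classes G) =
  mean mu (trunc T G) (fun w => - ln (pmf mu (trunc T G) w)).
Proof.
move=> md GT; rewrite /entropy.
pose I := [set w | exists2 x, Omega x & trunc T G x = w].
pose h w := Omega `&` [set y | trunc T G y = w].
have hE x : [set y | Omega y /\ agree G x y] = h (trunc T G x).
  by apply/seteqP; split=> y [Oy /(trunc_agree _ _ GT)].
have -> : classes G = h @` I.
  apply/seteqP; split=> C.
    by move=> [x Ox ->]; exists (trunc T G x); [exists x|rewrite hE].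
  by move=> [w [x Ox <-] <-]; exists x => //; rewrite hE.
rewrite fsbig_image; last first.
  move=> w w' /set_mem[x Ox <-] /set_mem[x' Ox' <-] e.
  have : h (trunc T G x') x by rewrite -e.
  by case.
have mt := measurable_trunc GT.
have hmu w : fine (mu (h w)) = pmf mu (trunc T G) w.
  by rewrite /h mu_setI //; exact: mt.
rewrite -(set_mem_set I) -(bigfs _ (r := index_enum _)) ?index_enum_uniq //; last first.
  by move=> w _; rewrite mem_index_enum.
rewrite mulrN mulr_sumr /mean -sumrN big_mkcond /=; apply: eq_bigr => w _.
have lnmd : ln (m d)%:R != 0 :> R by rewrite gt_eqF // ln_gt0 // ltr1n.
case: ifPn => [wI|]; first by rewrite hmu; field.
rewrite notin_setE => wI.
rewrite -hmu (_ : h w = set0) ?measure0 ?mul0r //.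
by apply/seteqP; split=> // x [Ox xw]; apply: wI; exists x.
Qed.

End Partitions.

(** * Lengths of the balls and numbers of levels *)

(** The number of l with q ^ l * i <= N, that is, of terms of the chain of i
    whose index is at most N. *)
Definition lev (q N i : nat) : nat := up_log q (N %/ i).+1.

Lemma ltn_lev q N i l : (1 < q)%N -> (0 < i)%N ->
  (l < lev q N i)%N = (q ^ l * i <= N)%N.
Proof.
move=> q1 i0; rewrite -leq_divRL // ltnNge; apply/negP/idP => [n|le].
  by rewrite -ltnS ltnNge; apply/negP => h; apply: n; exact: up_log_min.
move=> h; have := leq_trans (up_logP (N %/ i).+1 q1) (leq_pexp2l (ltnW q1) h).
by rewrite ltnNge le.
Qed.

Lemma leq_lev q N N' i : (N <= N')%N -> (lev q N i <= lev q N' i)%N.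
Proof. by move=> le; apply: leq_up_log; rewrite ltnS leq_div2r. Qed.

Lemma leq_lev1 q N i : (1 < q)%N -> (0 < i)%N -> (lev q N i <= lev q N 1)%N.
Proof.
move=> q1 i0; apply: leq_up_log.
by rewrite ltnS divn1 leq_div.
Qed.

Section Lengths.
Context {R : realType} (d : nat) (m : nat -> nat).
Hypothesis d_ge2 : (2 <= d)%N.
Hypothesis m_step : forall k, (1 <= k < d)%N -> (m k.+1 <= m k)%N.
Hypothesis md_ge2 : (2 <= m d)%N.

Lemma m_anti k k' : (1 <= k <= k')%N -> (k' <= d)%N -> (m k' <= m k)%N.
Proof.
move=> /andP[k1]; elim: k' => [|k' IH] kk' k'd; first by lia.
have [->//|ne] := eqVneq k k'.+1.
by apply: leq_trans (m_step _) (IH _ _); lia.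
Qed.

Lemma m_gt1 k : (1 <= k <= d)%N -> (1 < m k)%N.
Proof. by move=> k1d; apply: leq_trans md_ge2 (m_anti _ _); lia. Qed.

Lemma ln_m_gt0 k : (1 <= k <= d)%N -> 0 < ln (m k)%:R :> R.
Proof. by move=> kd; rewrite ln_gt0 // ltr1n m_gt1. Qed.

Lemma gamma_gt0 i : (2 <= i <= d)%N -> 0 < gamma R m i.
Proof. by move=> id; rewrite /gamma divr_gt0 // ln_m_gt0 //; lia. Qed.

Lemma gamma_le1 i : (2 <= i <= d)%N -> gamma R m i <= 1.
Proof.
move=> id; have mi := m_gt1 (k := i); have mi' := m_gt1 (k := i.-1).
rewrite /gamma ler_pdivrMr ?mul1r ?ln_m_gt0 //; last by lia.
by rewrite ler_ln ?posrE ?ltr0n ?ler_nat ?m_anti //; lia.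
Qed.

Let ceil_ge0 i n : (2 <= i <= d)%N -> (0 <= Num.ceil (n%:R / gamma R m i))%R.
Proof.
move=> id; rewrite -(ler_int R) (le_trans _ (Num.Theory.ceil_ge _)) ?num_real //.
by rewrite mulr_ge0 // invr_ge0 ltW // gamma_gt0.
Qed.

Lemma L_ge_div i n : (2 <= i <= d)%N -> n%:R / gamma R m i <= (L R m i n)%:R.
Proof.
move=> id; rewrite /L natr_absz ger0_norm ?ceil_ge0 //.
exact: Num.Theory.ceil_ge.
Qed.

Lemma L_le_div i n : (2 <= i <= d)%N ->
  (L R m i n)%:R <= n%:R / gamma R m i + 1.
Proof.
move=> id; rewrite /L natr_absz ger0_norm ?ceil_ge0 //.
have := Num.Theory.ceilB1_lt (n%:R / gamma R m i).
by rewrite intrD /= ltrBlDr => /ltW.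
Qed.

Lemma L_le i n c : (2 <= i <= d)%N -> n%:R / gamma R m i <= c%:R ->
  (L R m i n <= c)%N.
Proof.
move=> id h; rewrite -(ler_nat R) /L natr_absz ger0_norm ?ceil_ge0 //.
by rewrite [leRHS]pmulrn ler_int ceil_le_int -pmulrn.
Qed.

Lemma L_ge i n : (2 <= i <= d)%N -> (n <= L R m i n)%N.
Proof.
move=> id; rewrite -(ler_nat R) (le_trans _ (L_ge_div _ id)) //.
by rewrite ler_peMr // invf_ge1 ?gamma_gt0 // gamma_le1.
Qed.

Lemma L_homo i n n' : (2 <= i <= d)%N -> (n <= n')%N -> (L R m i n <= L R m i n')%N.
Proof.
move=> id nn'; apply: L_le => //; apply: le_trans (L_ge_div _ id).
by rewrite ler_wpM2r ?ler_nat // invr_ge0 ltW // gamma_gt0.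
Qed.

Lemma LcompS k n : (1 <= k)%N -> Lcomp R m k.+1 n = L R m k.+1 (Lcomp R m k n).
Proof. by case: k. Qed.

Lemma Lcomp_homo k n n' : (1 <= k <= d)%N -> (n <= n')%N ->
  (Lcomp R m k n <= Lcomp R m k n')%N.
Proof.
elim: k => // k IH kd nn'; have [->//|k0] := posnP k.
by rewrite !LcompS // L_homo ?IH //; lia.
Qed.

Lemma Lcomp_leq k k' n : (1 <= k <= k')%N -> (k' <= d)%N ->
  (Lcomp R m k n <= Lcomp R m k' n)%N.
Proof.
move=> /andP[k1]; elim: k' => [|k' IH] kk' k'd; first by lia.
have [->//|ne] := eqVneq k k'.+1.
rewrite LcompS; last by lia.
by apply: leq_trans (IH _ _) (L_ge _ _); lia.
Qed.

Lemma Lcomp_linear k : (1 <= k <= d)%N ->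
  exists C : nat, forall n, (Lcomp R m k n <= C * n)%N.
Proof.
elim: k => // k IH kd; have [->|k0] := posnP k.
  by exists 1%N => n; rewrite mul1n.
have [|C HC] := IH; first by lia.
have id : (2 <= k.+1 <= d)%N by lia.
have g0 : 0 <= (gamma R m k.+1)^-1 by rewrite invr_ge0 ltW // gamma_gt0.
pose c := Num.bound (gamma R m k.+1)^-1.
have cg : (gamma R m k.+1)^-1 <= c%:R by apply: ltW; apply: archi_boundP.
exists (c * C)%N => n; rewrite LcompS //; apply: L_le => //.
rewrite -mulnA natrM mulrC; apply: ler_pM => //.
by rewrite ler_nat.
Qed.

End Lengths.

(** * The information of a ball *)

Lemma ln_prod (R : realType) (I : Type) (s : seq I) (P : pred I) (F : I -> R) :
  (forall i, 0 <= F i) -> \prod_(i <- s | P i) F i != 0 ->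
  ln (\prod_(i <- s | P i) F i) = \sum_(i <- s | P i) ln (F i).
Proof.
move=> F0; elim: s => [|i s IH]; first by rewrite !big_nil ln1.
rewrite !big_cons; case: ifP => // Pi; rewrite mulf_eq0 negb_or => /andP[a b].
by rewrite lnM ?IH // posrE lt0r ?a ?b ?F0 // prodr_ge0.
Qed.

Section BallMass.
Context {R : realType} {d : nat} {m : nat -> nat}.
Hypothesis d_ge2 : (2 <= d)%N.
Hypothesis m_step : forall k, (1 <= k < d)%N -> (m k.+1 <= m k)%N.
Hypothesis md_ge2 : (2 <= m d)%N.
Variable Pmu : probability (Sigma d m) R.

Lemma Ball_agree n (x : Sigma d m) : Ball R n x =
  [set u | agree (fun i (k : 'I_d) => (i < Lcomp R m k.+1 n)%N) x u].
Proof.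
apply/seteqP; split=> u h; first by move=> i k lt; exact: (h k i.+1).
by move=> k [//|i] lt; exact: (h i k).
Qed.

Lemma measurable_Ball n (x : Sigma d m) : measurable (Ball R n x).
Proof. by rewrite Ball_agree; exact: measurable_agree. Qed.

Definition info n (x : Sigma d m) : R := - ln (fine (Pmu (Ball R n x))).

Lemma info_homo n n' x : fine (Pmu (Ball R n' x)) != 0 -> (n <= n')%N ->
  info n x <= info n' x.
Proof.
move=> nz nn'.
have sub : (Pmu (Ball R n' x) <= Pmu (Ball R n x))%E.
  apply: le_measure; rewrite ?inE; [exact: measurable_Ball|exact: measurable_Ball|].
  move=> u h k i /andP[i0 iN]; apply: h; rewrite i0 (leq_trans iN) //.
  by apply: (@Lcomp_homo R d) => //; have := ltn_ord k; lia.
have fin k : Pmu (Ball R k x) \is a fin_num.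
  by rewrite fin_num_measure //; exact: measurable_Ball.
have p' : 0 < fine (Pmu (Ball R n' x)).
  by rewrite lt0r nz fine_ge0.
have pp : fine (Pmu (Ball R n' x)) <= fine (Pmu (Ball R n x)).
  by rewrite fine_le.
by rewrite lerN2 ler_ln ?posrE // (lt_le_trans p').
Qed.

Lemma null_Ball n :
  measurable [set x | fine (Pmu (Ball R n x)) == 0] /\
  Pmu [set x | fine (Pmu (Ball R n x)) == 0] = 0%E.
Proof.
pose G i (k : 'I_d) := (i < Lcomp R m k.+1 n)%N.
have GN i k : G i k -> (i < Lcomp R m d n)%N.
  move=> lt; apply: leq_trans lt _.
  by apply: (@Lcomp_leq R d) => //; have := ltn_ord k; lia.
have mG := measurable_trunc (m := m) GN.
have -> : [set x | fine (Pmu (Ball R n x)) == 0] =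
   [set x | pmf Pmu (trunc (Lcomp R m d n) G) (trunc (Lcomp R m d n) G x) == 0].
  by apply/seteqP; split=> x /=; rewrite pmf_trunc // Ball_agree.
split; last exact: null_fibers.
exact: (measurable_preimage [pred w | pmf Pmu (trunc (Lcomp R m d n) G) w == 0] mG).
Qed.

End BallMass.

Section BallEntropy.
Context {R : realType} {d q : nat} {m : nat -> nat}.
Hypotheses (d_ge2 : (2 <= d)%N) (q_gt1 : (1 < q)%N).
Hypothesis m_step : forall k, (1 <= k < d)%N -> (m k.+1 <= m k)%N.
Hypothesis md_ge2 : (2 <= m d)%N.
Variables (mu Pmu : probability (Sigma d m) R).
Hypothesis hPmu : is_telescopic_product q mu Pmu.

Local Notation N n := (Lcomp R m d n).

Definition profile n i k := lev q (Lcomp R m k n) i.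

Lemma profile_bounded n i l (k : 'I_d) : ~~ (q %| i)%N ->
  levels (profile n i) l k -> (l < lev q (N n) 1)%N.
Proof.
move=> qi h.
have i0 := qfree_gt0 qi.
apply: leq_trans h (leq_trans (leq_lev _ _ _) (leq_lev1 _ q_gt1 i0)).
by apply: (@Lcomp_leq R d) => //; have := ltn_ord k; lia.
Qed.

(** The entry of index q ^ l * i lies within the length of a coordinate
    exactly when l is below its number of levels, so a ball constrains each
    chain separately. *)
Lemma Ball_chains n (x : Sigma d m) :
  Ball R n x = [set u | forall i, (i <= N n)%N -> ~~ (q %| i)%N ->
    agree (levels (profile n i)) (chain q i x) (chain q i u)].
Proof.
apply/seteqP; split=> u h.
  move=> i _ qi l k; rewrite /levels /profile.
  have i0 := qfree_gt0 qi.
  rewrite ltn_lev // => le; apply: (h k (q ^ l * i)%N).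
  by rewrite le muln_gt0 expn_gt0 (ltnW q_gt1) i0.
move=> k j /andP[j0 jN].
have [l [i [jE qi /andP[i0 ij]]]] := qfree_factor q_gt1 j0.
have iN : (i <= N n)%N.
  apply: leq_trans ij (leq_trans jN _).
  by apply: (@Lcomp_leq R d) => //; have := ltn_ord k; lia.
have := h i iN qi l k; rewrite /levels /profile ltn_lev // jE => /(_ jN).
by rewrite /chain jE.
Qed.

(** Equal to info off a null set, but a sum over the chains at every point. *)
Definition chain_info n (x : Sigma d m) : R :=
  \sum_(i < (N n).+1 | ~~ (q %| i)%N)
    - ln (fine (mu [set y | agree (levels (profile n i)) (chain q i x) y])).

Lemma Ball_mass n x : fine (Pmu (Ball R n x)) =
  \prod_(i < (N n).+1 | ~~ (q %| i)%N)
    fine (mu [set y | agree (levels (profile n i)) (chain q i x) y]).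
Proof.
pose F i : nat -> 'I_d -> bool :=
  if (q %| i)%N then fun _ _ => false else levels (profile n i).
have FT i l k : F i l k -> (l < lev q (N n) 1)%N.
  by rewrite /F; case: ifPn => // qi; exact: profile_bounded.
have -> : Ball R n x = [set u | forall i, (i <= N n)%N -> ~~ (q %| i)%N ->
    agree (F i) (chain q i x) (chain q i u)].
  rewrite Ball_chains; apply/seteqP; split=> u h i iN qi.
    by rewrite /F (negbTE qi); exact: h.
  by have := h i iN qi; rewrite /F (negbTE qi).
rewrite (chain_law q_gt1 hPmu _ (fun i => chain q i x) FT); apply: eq_bigr => i qi.
by rewrite /F (negbTE qi).
Qed.

Lemma info_chains n x : fine (Pmu (Ball R n x)) != 0 ->
  info Pmu n x = chain_info n x.
Proof.
rewrite /info /chain_info Ball_mass sumrN => nz; congr (- _).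
by apply: ln_prod => // i; exact: fine_ge0.
Qed.

Variables (Omega : set (Sigma d m)).
Hypotheses (closed_Omega : closed Omega) (mu_Omega : mu Omega = 1%E).

(** Entropy in natural logarithm of the partition seen by a chain with r k
    levels in the coordinate k. *)
Definition entropy_nat (r : nat -> nat) : R :=
  ln (m d)%:R * entropy mu (classes Omega (levels r)).

Definition mean_info n : R :=
  \sum_(i < (N n).+1 | ~~ (q %| i)%N) entropy_nat (profile n i).

Lemma entropy_nat_bounds T (r : nat -> nat) :
  (forall l (k : 'I_d), levels r l k -> (l < T)%N) ->
  0 <= entropy_nat r <= T%:R * ln #|{: letter d m}|%:R.
Proof.
move=> rT; rewrite /entropy_nat (entropy_classes closed_Omega mu_Omega _ rT) //.
have -> : T%:R * ln #|{: letter d m}|%:R =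
   ln #|{ffun 'I_T -> letter d m}|%:R :> R.
  rewrite card_ffun card_ord natrX lnXn ?mulr_natl // ltr0n.
  by apply/card_gt0P; exists point.
have mt := measurable_trunc rT.
have E : mean mu (trunc T (levels r)) (fun w => - ln (pmf mu (trunc T (levels r)) w))
   = \sum_w - (pmf mu (trunc T (levels r)) w * ln (pmf mu (trunc T (levels r)) w)).
  by apply: eq_bigr => w _; rewrite mulrN.
rewrite E entropy_ge0 ?entropy_le //; try exact: pmf_ge0.
all: exact: pmf_sum1.
Qed.

(** Chains contribute logarithms of probabilities of words of length at most
    lev q N 1, so their second moments are at most quadratic in that length,
    which is itself logarithmic in N. *)
Lemma ball_chebyshev n (e : R) : 0 < e ->
  let A := [set x | e <= `|chain_info n x - mean_info n|] in
  measurable A /\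
  (Pmu A <= (((N n).+1%:R *
     (2 * ((lev q (N n) 1)%:R * ln #|{: letter d m}|%:R) ^+ 2 + 8)) / e ^+ 2)%:E)%E.
Proof.
move=> e0 A; set T := lev q (N n) 1.
pose qf := [pred i : 'I_(N n).+1 | ~~ (q %| i)%N].
pose I := 'I_#|qf|.
have qfI (j : I) : ~~ (q %| enum_val j)%N by have := enum_valP j.
pose Z (j : I) : Sigma d m -> {ffun 'I_T -> letter d m} :=
  trunc T (levels (profile n (enum_val j))).
pose X (j : I) : Sigma d m -> {ffun 'I_T -> letter d m} := Z j \o chain q (enum_val j).
have bd (j : I) l (k : 'I_d) : levels (profile n (enum_val j)) l k -> (l < T)%N.
  exact: profile_bounded (qfI j).
have mZ j : measurable_fibers (Z j) by exact: measurable_trunc (bd j).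
have mX j : measurable_fibers (X j).
  exact: (measurable_trunc_at (fun l => (q ^ l * enum_val j).-1) (bd j)).
have pX j w : pmf Pmu (X j) w = pmf mu (Z j) w.
  exact: (chain_pmf q_gt1 hPmu _ (bd j) (qfI j)).
pose f (j : I) w := - ln (pmf mu (Z j) w).
have redE (F : nat -> R) : \sum_(i < (N n).+1 | ~~ (q %| i)%N) F i =
    \sum_(j < #|qf|) F (enum_val j).
  by rewrite -(big_enum_val (A := qf) (fun i : 'I_(N n).+1 => F i)).
have infoE x : chain_info n x = \sum_j f j (X j x).
  rewrite /chain_info (redE (fun i =>
    - ln (fine (mu [set y | agree (levels (profile n i)) (chain q i x) y])))).
  by apply: eq_bigr => j _; rewrite /f (pmf_trunc mu _ (bd j)).
have meanE : mean_info n = \sum_j mean Pmu (X j) (f j).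
  rewrite /mean_info (redE (fun i => entropy_nat (profile n i))).
  apply: eq_bigr => j _.
  rewrite /entropy_nat (entropy_classes closed_Omega mu_Omega _ (bd j)) //.
  by apply: eq_bigr => w _; rewrite pX.
have -> : A = [set x | e <= `|\sum_j f j (X j x) - \sum_j mean Pmu (X j) (f j)|].
  by apply/seteqP; split=> x /=; rewrite /A /= infoE meanE.
have indep (i j : I) w w' : i != j ->
    pmf Pmu (fun x => (X i x, X j x)) (w, w') = pmf Pmu (X i) w * pmf Pmu (X j) w'.
  move=> ij; rewrite !pX.
  apply: (chain_pmf_pair q_gt1 hPmu _ _ (bd i) (bd j) (qfI i) (qfI j)).
  by apply: contra_neq ij => /val_inj/enum_val_inj.
split.
  have := measurable_preimage [pred y : {ffun I -> _} |
    e <= `|\sum_j f j (y j) - \sum_j mean Pmu (X j) (f j)|]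
    (measurable_fibers_ffun mX).
  congr (measurable _); apply/seteqP; split => x /=.
    by under eq_bigr do rewrite ffunE.
  by under [X in _ -> _ <= `|X - _|]eq_bigr do rewrite ffunE.
apply: le_trans (chebyshev_pairwise f e0 mX indep) _.
rewrite lee_fin ler_wpM2r ?invr_ge0 ?sqr_ge0 //.
set K := 2 * _ + 8.
have K0 : 0 <= K by rewrite /K addr_ge0 // mulr_ge0 // sqr_ge0.
apply: (@le_trans _ _ (\sum_(j : I) K)).
  apply: ler_sum => j _.
  rewrite /K.
  have -> : T%:R * ln #|{: letter d m}|%:R =
    ln #|{ffun 'I_T -> letter d m}|%:R :> R.
    rewrite card_ffun card_ord natrX lnXn ?mulr_natl // ltr0n.
    by apply/card_gt0P; exists point.
  have -> : mean Pmu (X j) (fun w => f j w ^+ 2) =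
      \sum_w pmf mu (Z j) w * (- ln (pmf mu (Z j) w)) ^+ 2.
    by apply: eq_bigr => w _; rewrite pX.
  apply: log_second_moment_le; first exact: pmf_ge0.
  exact: pmf_sum1.
rewrite sumr_const -[_ *+ #|_|]mulr_natl ler_wpM2r // ler_nat.
by rewrite card_ord (leq_trans (max_card _)) // card_ord.
Qed.

End BallEntropy.

(** * Almost sure convergence *)

Section Interpolation.
Context {R : realType}.

Lemma cvg_sixth_power_ratio :
  (fun j : nat => (j.+1%:R / j.+2%:R) ^+ 6 : R) @ \oo --> (1 : R).
Proof.
have -> : (fun j : nat => (j.+1%:R / j.+2%:R) ^+ 6 : R) =
    (fun x : R => x ^+ 6) \o (fun j => 1 - harmonic j.+1).
  apply/funext => j; rewrite /harmonic /=.
  have h : j.+2%:R != 0 :> R by rewrite pnatr_eq0.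
  by rewrite -[j.+1%:R](addrK 1) natr1 mulrBl divff // mul1r.
have lim1 : (fun j => 1 - harmonic j.+1 : R) @ \oo --> (1 - 0 : R).
  apply: cvgB; first exact: cvg_cst.
  by rewrite (@cvg_shiftS R^o (@harmonic R)); exact: cvg_harmonic.
by have := cvg_comp _ _ lim1 (@exprn_continuous R 6 _); rewrite subr0 expr1n.
Qed.

(** Consecutive sixth powers have a ratio tending to 1, so monotonicity
    controls S in between. *)
Lemma cvg_from_sixth_powers (S : nat -> R) (D : R) :
  (forall n, 0 <= S n) -> {homo S : n n' / (n <= n')%N >-> n <= n'} ->
  (fun j => S (j.+1 ^ 6)%N / (j.+1 ^ 6)%:R) @ \oo --> D ->
  (fun n => S n / n%:R) @ \oo --> D.
Proof.
move=> S0 Smono uD.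
have /choice[k kP] : forall n, exists k,
    (0 < n)%N -> ((k.+1 ^ 6 <= n)%N && (n < k.+2 ^ 6)%N).
  elim=> [|n [k IH]]; first by exists 0%N.
  have [->|n0] := posnP n; first by exists 0%N.
  have /andP[lo hi] := IH n0.
  have [lt|le] := ltnP n.+1 (k.+2 ^ 6); first by exists k => _; rewrite lt leqW.
  exists k.+1 => _; rewrite le /=; apply: leq_ltn_trans hi _.
  by rewrite ltn_exp2r.
have koo : k @ \oo --> \oo.
  apply/cvgnyPge => A; near=> n.
  have n0 : (0 < n)%N by near: n; exact: nbhs_infty_gt.
  have /andP[_ hi] := kP n n0.
  have : (A.+2 ^ 6 <= n)%N by near: n; exact: nbhs_infty_ge.
  move=> /leq_ltn_trans/(_ hi); rewrite ltn_exp2r // !ltnS => lt.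
  by rewrite ltnW.
pose u j := S (j.+1 ^ 6)%N / (j.+1 ^ 6)%:R.
pose r j : R := (j.+1%:R / j.+2%:R) ^+ 6.
have lo : (fun n => u (k n) * r (k n)) @ \oo --> D.
  rewrite -[D]mulr1; apply: cvgM.
    exact: (cvg_comp _ _ koo uD).
  exact: (cvg_comp _ _ koo cvg_sixth_power_ratio).
have hi : (fun n => u (k n).+1 / r (k n)) @ \oo --> D.
  rewrite -[D]divr1; apply: cvgM.
    have uS : (fun j => u j.+1) @ \oo --> D.
      by rewrite (@cvg_shiftS R^o u).
    exact: (cvg_comp _ _ koo uS).
  apply: cvgV; first exact: oner_neq0.
  exact: (cvg_comp _ _ koo cvg_sixth_power_ratio).
apply: squeeze_cvgr lo hi; near=> n.
have n0 : (0 < n)%N by near: n; exact: nbhs_infty_gt.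
have /andP[le lt] := kP n n0.
rewrite /u /r !natrX expr_div_n.
have p1 : 0 < (k n).+1%:R ^+ 6 :> R by rewrite exprn_gt0.
have p2 : 0 < (k n).+2%:R ^+ 6 :> R by rewrite exprn_gt0.
have pn : 0 < n%:R :> R by rewrite ltr0n.
apply/andP; split.
  rewrite mulrA divfK ?gt_eqF // ler_pM ?invr_ge0 ?exprn_ge0 ?ler0n ?Smono //.
  by rewrite lef_pV2 ?posrE // -natrX ler_nat ltnW.
rewrite invf_div mulrA divfK ?gt_eqF // ler_pM ?invr_ge0 ?ler0n ?Smono //.
  by rewrite ltnW.
by rewrite lef_pV2 ?posrE // -natrX ler_nat.
Unshelve. all: by end_near. Qed.

Lemma sum_inv_sqr_le n : \sum_(k < n) (k.+1%:R ^- 2) <= 2 :> R.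
Proof.
suff : \sum_(k < n) (k.+1%:R ^- 2) <= 2 - 2 / n.+1%:R :> R.
  by move/le_trans; apply; rewrite lerBlDr lerDl mulr_ge0 // invr_ge0.
elim: n => [|n IH]; first by rewrite big_ord0 divr1 subrr.
rewrite big_ord_recr /=; apply: le_trans (lerD IH (lexx _)) _.
have a0 : 0 < n.+1%:R :> R by rewrite ltr0n.
rewrite -[n.+2%:R]natr1; set a : R := n.+1%:R in a0 *.
have a1 : 1 <= a by rewrite ler1n.
rewrite -subr_ge0.
have -> : 2 - 2 / (a + 1) - (2 - 2 / a + a ^- 2) = (a - 1) / (a ^+ 2 * (a + 1)).
  by field; rewrite !gt_eqF //; lra.
by rewrite divr_ge0 ?subr_ge0 // mulr_ge0 ?sqr_ge0 //; lra.
Qed.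

End Interpolation.

Section AlmostSure.
Context {R : realType} {d q : nat} {m : nat -> nat}.
Hypotheses (d_ge2 : (2 <= d)%N) (q_gt1 : (1 < q)%N).
Hypothesis m_step : forall k, (1 <= k < d)%N -> (m k.+1 <= m k)%N.
Hypothesis md_ge2 : (2 <= m d)%N.
Variables (mu Pmu : probability (Sigma d m) R).
Hypothesis hPmu : is_telescopic_product q mu Pmu.
Variables (Omega : set (Sigma d m)).
Hypotheses (closed_Omega : closed Omega) (mu_Omega : mu Omega = 1%E).

Local Notation N n := (Lcomp R m d n).
Local Notation mean_info := (@mean_info R d q m mu Omega).
Local Notation chain_info := (@chain_info R d q m mu).

(** The variance of the information of a ball of index n is at most of order n
    (log n)^2. At n = (j + 1)^6, with log n replaced by j + 1, the variance is
    of order (j + 1)^8, and the tolerance (j + 1)^5 = n / (j + 1) makes the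
    Chebyshev bound a multiple of (j + 1)^(-2). *)
Definition deviation (j : nat) : set (Sigma d m) :=
  [set x | (j.+1 ^ 5)%:R <=
    `|chain_info (j.+1 ^ 6)%N x - mean_info (j.+1 ^ 6)%N| ].

Lemma deviation_null : Pmu (lim_sup_set deviation) = 0%E.
Proof.
have cheb j := ball_chebyshev d_ge2 q_gt1 m_step md_ge2 hPmu closed_Omega
  mu_Omega (j.+1 ^ 6) (e := (j.+1 ^ 5)%:R).
have p5 j : 0 < (j.+1 ^ 5)%:R :> R by rewrite ltr0n expn_gt0.
apply: lim_sup_set_cvg0; first by move=> j; case: (cheb j (p5 j)).
have [|C NC] := @Lcomp_linear R d m d_ge2 m_step md_ge2 d; first by lia.
set c : R := ln #|{: letter d m}|%:R in cheb.
have c0 : 0 <= c.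
  by rewrite ln_ge0 // ler1n; apply/card_gt0P; exists point.
pose K : R := C.+1%:R * (2 * ((C + 7)%:R * c) ^+ 2 + 8).
have K0 : 0 <= K by rewrite mulr_ge0 // addr_ge0 // mulr_ge0 // sqr_ge0.
have bound j : (Pmu (deviation j) <= (K * j.+1%:R ^- 2)%:E)%E.
  have [_ /le_trans] := cheb j (p5 j); apply.
  rewrite lee_fin; set a : R := j.+1%:R.
  have NC1 : (N (j.+1 ^ 6) < C.+1 * j.+1 ^ 6)%N.
    have := NC (j.+1 ^ 6)%N; have : (0 < j.+1 ^ 6)%N by rewrite expn_gt0.
    by rewrite mulSn; lia.
  have a0 : 0 < a by rewrite ltr0n.
  have h1 : (N (j.+1 ^ 6)).+1%:R <= C.+1%:R * a ^+ 6.
    by rewrite /a -natrX -natrM ler_nat.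
  (* The constant comes from C.+1 * b ^ 6 <= q ^ C.+1 * q ^ (b * 6). *)
  have h2 : (lev q (N (j.+1 ^ 6)) 1)%:R <= (C + 7)%:R * a.
    rewrite /a -natrM ler_nat; apply: up_log_min => //.
    rewrite divn1; apply: (@leq_trans (C.+1 * j.+1 ^ 6)) => //.
    apply: (@leq_trans (q ^ C.+1 * q ^ (j.+1 * 6))).
      apply: leq_mul; first exact/ltnW/ltn_expl.
      by rewrite expnM leq_exp2r // ltnW // ltn_expl.
    by rewrite -expnD leq_pexp2l ?(ltnW q_gt1) //; lia.
  have h3 : 2 * ((lev q (N (j.+1 ^ 6)) 1)%:R * c) ^+ 2 + 8 <=
      (2 * ((C + 7)%:R * c) ^+ 2 + 8) * a ^+ 2.
    have a1 : 1 <= a ^+ 2 by rewrite exprn_ege1 // ler1n.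
    rewrite [leRHS]mulrDl lerD //; last by rewrite ler_peMr.
    rewrite -mulrA ler_wpM2l // -[leRHS]exprMn.
    rewrite lerXn2r ?nnegrE ?mulr_ge0 // ?(ltW a0) //.
    by rewrite [leRHS]mulrAC ler_wpM2r.
  rewrite ler_pdivrMr ?exprn_gt0 //.
  have -> : K / a ^+ 2 * (j.+1 ^ 5)%:R ^+ 2 =
      C.+1%:R * a ^+ 6 * ((2 * ((C + 7)%:R * c) ^+ 2 + 8) * a ^+ 2).
    by rewrite natrX -/a /K; field; rewrite gt_eqF.
  apply: ler_pM => //.
  by rewrite addr_ge0 // mulr_ge0 // sqr_ge0.
apply: (@le_lt_trans _ _ (K * 2)%:E); last exact: ltry.
apply: lime_le; first by apply: is_cvg_nneseries => *; exact: measure_ge0.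
apply: nearW => n; rewrite big_mkord.
apply: (@le_trans _ _ (\sum_(j < n) (K * j.+1%:R ^- 2)%:E)%E).
  by apply: lee_sum => j _; exact: bound.
by rewrite sumEFin lee_fin -mulr_sumr ler_wpM2l // sum_inv_sqr_le.
Qed.

(** Borel-Cantelli applies along sixth powers; in between, the information is
    squeezed because balls decrease. *)
Lemma info_cvg_ae (D : R) : (fun n => mean_info n / n%:R) @ \oo --> D ->
  {ae Pmu, forall x, (forall n, fine (Pmu (Ball R n x)) != 0) /\
     (fun n => info Pmu n x / n%:R) @ \oo --> D}.
Proof.
move=> meanD.
pose Z n := [set x : Sigma d m | fine (Pmu (Ball R n x)) == 0].
have negl : Pmu.-negligible (lim_sup_set deviation `|` \bigcup_n Z n).
  apply: negligibleU.
    apply/negligibleP; last exact: deviation_null.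
    apply: bigcap_measurable => [|n _]; first by exists 0%N.
    apply: bigcup_measurable => j _.
    have := ball_chebyshev d_ge2 q_gt1 m_step md_ge2 hPmu closed_Omega
      mu_Omega (j.+1 ^ 6) (e := (j.+1 ^ 5)%:R).
    by case; rewrite ?ltr0n ?expn_gt0.
  apply: negligible_bigcup => n.
  have [mZ Z0] := null_Ball d_ge2 m_step md_ge2 Pmu n.
  exact/negligibleP.
apply: negligibleS negl => x /=; apply: contra_notP.
move=> /not_orP[ndev nZ].
have nz n : fine (Pmu (Ball R n x)) != 0.
  by apply/negP => h; apply: nZ; exists n.
split=> //.
apply: cvg_from_sixth_powers.
- move=> n; rewrite oppr_ge0 ln_le0 // -[leRHS]/(fine 1%:E) fine_le //.
    by rewrite fin_num_measure //; exact: measurable_Ball.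
  by apply: probability_le1; exact: measurable_Ball.
- by move=> n n'; exact: info_homo.
have [n0 Hn0] : exists n0, forall j, (n0 <= j)%N -> ~ deviation j x.
  apply: contrapT => /forallNP h; apply: ndev => n _.
  have /existsNP[j] := h n.
  by move=> /not_implyP[nj /contrapT dj]; exists j.
have mean6 : (fun j => mean_info (j.+1 ^ 6)%N / (j.+1 ^ 6)%:R) @ \oo --> D.
  apply: (@cvg_comp _ _ _ (fun j => (j.+1 ^ 6)%N) _ _ \oo) meanD.
  apply/cvgnyPge => A; near=> j.
  have jA : (A <= j)%N by near: j; exact: nbhs_infty_ge.
  by apply: leq_trans jA (leq_trans (leqnSn j) _); rewrite -{1}(expn1 j.+1) leq_pexp2l.
have hz : (fun j : nat => (j.+1)%:R^-1 : R) @ \oo --> 0 by exact: cvg_harmonic.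
apply: (@squeeze_cvgr _ _ _ _
  (fun j => mean_info (j.+1 ^ 6)%N / (j.+1 ^ 6)%:R - (j.+1)%:R^-1)
  (fun j => mean_info (j.+1 ^ 6)%N / (j.+1 ^ 6)%:R + (j.+1)%:R^-1)).
- near=> j.
  have jn : (n0 <= j)%N by near: j; exact: nbhs_infty_ge.
  have /negP := Hn0 _ jn; rewrite -ltNge -(info_chains d_ge2 q_gt1 m_step md_ge2 hPmu) //.
  have p : 0 < (j.+1 ^ 6)%:R :> R by rewrite ltr0n expn_gt0.
  have -> : j.+1%:R^-1 = (j.+1 ^ 5)%:R / (j.+1 ^ 6)%:R :> R.
    have a0 : j.+1%:R != 0 :> R by rewrite pnatr_eq0.
    by rewrite !natrX; move: a0; set a := j.+1%:R => a0; field.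
  rewrite ltr_norml => /andP[/ltW lo /ltW hi].
  by rewrite -mulrBl -mulrDl !ler_wpM2r ?invr_ge0 ?(ltW p) //; lra.
- by rewrite -[D]subr0; apply: cvgB.
- by rewrite -[D]addr0; apply: cvgD.
Unshelve. all: by end_near. Qed.

End AlmostSure.

(** * Growth rates *)

Section LinearGrowth.
Context {R : realType}.
Implicit Types (u v : nat -> nat) (x y X : R).

Lemma cvg_inv_nat : (fun n => (n%:R)^-1 : R) @ \oo --> (0 : R).
Proof.
by rewrite -(@cvg_shiftS R^o (fun n => (n%:R)^-1 : R)); exact: cvg_harmonic.
Qed.

(** Bounded perturbations do not affect a growth rate; this is how all integer
    parts are discarded. *)
Lemma rate_perturb (f g : nat -> R) b x :
  (forall n, `|f n - g n| <= b) ->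
  (fun n => f n / n%:R) @ \oo --> x -> (fun n => g n / n%:R) @ \oo --> x.
Proof.
move=> fg fx.
have bx : (fun n => b * n%:R^-1) @ \oo --> (0 : R).
  by rewrite -[X in _ --> X](mulr0 b); apply: cvgM; [exact: cvg_cst|exact: cvg_inv_nat].
apply: (@squeeze_cvgr _ _ _ _ (fun n => f n / n%:R - b * n%:R^-1)
  (fun n => f n / n%:R + b * n%:R^-1)).
- apply: nearW => n; have := fg n; rewrite ler_norml => /andP[lo hi].
  rewrite -mulrBl -mulrDl !ler_wpM2r ?invr_ge0 //; lra.
- by rewrite -[x]subr0; apply: cvgB.
- by rewrite -[x]addr0; apply: cvgD.
Qed.

Lemma divn_approx n c : (0 < c)%N -> `|n%:R / c%:R - (n %/ c)%:R| <= 1 :> R.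
Proof.
move=> c0; have c0' : 0 < c%:R :> R by rewrite ltr0n.
rewrite {1}(divn_eq n c) natrD natrM mulrDl mulfK ?gt_eqF // addrAC subrr add0r.
rewrite ger0_norm ?divr_ge0 // ler_pdivrMr // mul1r ler_nat.
exact/ltnW/ltn_pmod.
Qed.

Lemma rate_divn u c x : (0 < c)%N ->
  (fun n => (u n)%:R / n%:R) @ \oo --> x ->
  (fun n => (u n %/ c)%:R / n%:R) @ \oo --> x / c%:R.
Proof.
move=> c0 ux; apply: (@rate_perturb (fun n => (u n)%:R / c%:R) _ 1).
  by move=> n; exact: divn_approx.
rewrite (_ : (fun n => _) = (fun n => (u n)%:R / n%:R * c%:R^-1)); last first.
  by apply/funext => n; rewrite mulrAC.
by apply: cvgM => //; exact: cvg_cst.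
Qed.

Lemma rate_maxn_le u v X :
  (exists2 x : R, (fun n => (u n)%:R / n%:R) @ \oo --> x & x <= X) ->
  (exists2 y : R, (fun n => (v n)%:R / n%:R) @ \oo --> y & y <= X) ->
  exists2 z : R, (fun n => (maxn (u n) (v n))%:R / n%:R) @ \oo --> z & z <= X.
Proof.
move=> [x ux xX] [y vy yX]; exists (Num.max x y); last by rewrite ge_max xX.
rewrite maxr_absE.
rewrite (_ : (fun n => _) = (fun n => ((u n)%:R / n%:R + (v n)%:R / n%:R +
    `|(u n)%:R / n%:R - (v n)%:R / n%:R|) / 2)); last first.
  apply/funext => n; rewrite -maxr_absE -maxr_pMl ?invr_ge0 //; congr (_ / _).
  by rewrite /maxn /Num.max ltr_nat; case: ifP.
apply: cvgM; last exact: cvg_cst.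
by apply: cvgD; [exact: cvgD|apply: cvg_norm; exact: cvgB].
Qed.

Lemma rate_minn_ge u v X :
  (exists2 x : R, (fun n => (u n)%:R / n%:R) @ \oo --> x & X <= x) ->
  (exists2 y : R, (fun n => (v n)%:R / n%:R) @ \oo --> y & X <= y) ->
  exists2 z : R, (fun n => (minn (u n) (v n))%:R / n%:R) @ \oo --> z & X <= z.
Proof.
move=> [x ux xX] [y vy yX]; exists (Num.min x y); last by rewrite le_min xX.
rewrite minr_absE.
rewrite (_ : (fun n => _) = (fun n => ((u n)%:R / n%:R + (v n)%:R / n%:R -
    `|(u n)%:R / n%:R - (v n)%:R / n%:R|) / 2)); last first.
  apply/funext => n; rewrite -minr_absE -minr_pMl ?invr_ge0 //; congr (_ / _).
  by rewrite /minn /Num.min ltr_nat; case: ifP.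
apply: cvgM; last exact: cvg_cst.
by apply: cvgB; [exact: cvgD|apply: cvg_norm; exact: cvgB].
Qed.

Lemma rate_bigmaxn_le (s : seq nat) (u : nat -> nat -> nat) X : 0 <= X ->
  (forall k, k \in s ->
     exists2 x : R, (fun n => (u k n)%:R / n%:R) @ \oo --> x & x <= X) ->
  exists2 z : R, (fun n => (\max_(k <- s) u k n)%:R / n%:R) @ \oo --> z & z <= X.
Proof.
move=> X0; elim: s => [|k s IH] h.
  exists 0 => //; rewrite (_ : (fun n => _) = fun=> 0); first exact: cvg_cst.
  by apply/funext => n; rewrite big_nil mul0r.
rewrite (_ : (fun n => _) =
  fun n => (maxn (u k n) (\max_(j <- s) u j n))%:R / n%:R); last first.
  by apply/funext => n; rewrite big_cons.
apply: rate_maxn_le; first by apply: h; rewrite mem_head.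
by apply: IH => j js; apply: h; rewrite inE js orbT.
Qed.

Lemma rate_bigminn_ge (s : seq nat) (P : pred nat) (u : nat -> nat -> nat) v X :
  (exists2 y : R, (fun n => (v n)%:R / n%:R) @ \oo --> y & X <= y) ->
  (forall k, k \in s -> P k ->
     exists2 x : R, (fun n => (u k n)%:R / n%:R) @ \oo --> x & X <= x) ->
  exists2 z : R, (fun n => (\big[minn/v n]_(k <- s | P k) u k n)%:R / n%:R) @ \oo --> z
           & X <= z.
Proof.
move=> hv; elim: s => [|k s IH] h.
  rewrite (_ : (fun n => _) = fun n => (v n)%:R / n%:R) //.
  by apply/funext => n; rewrite big_nil.
have {}IH := IH (fun j js => h j (mem_behead (s := k :: s) js)).
have [Pk|nPk] := boolP (P k); last first.
  rewrite (_ : (fun n => _) =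
    fun n => (\big[minn/v n]_(k <- s | P k) u k n)%:R / n%:R) //.
  by apply/funext => n; rewrite big_cons (negbTE nPk).
rewrite (_ : (fun n => _) =
  fun n => (minn (u k n) (\big[minn/v n]_(k <- s | P k) u k n))%:R / n%:R).
  by apply: rate_minn_ge => //; apply: h; rewrite ?mem_head.
by apply/funext => n; rewrite big_cons Pk.
Qed.

(** The index 0 does not count, since q divides it. *)
Definition qfree_count (q N : nat) : nat := \sum_(i < N.+1) ~~ (q %| i)%N.

Lemma qfree_count_div q N : (0 < q)%N -> (qfree_count q N + N %/ q)%N = N.
Proof.
move=> q0; elim: N => [|N IH].
  by rewrite /qfree_count big_ord_recl big_ord0 dvdn0 div0n.
rewrite /qfree_count big_ord_recr /= -/(qfree_count q N) divnS //.
by case: (q %| _)%N; lia.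
Qed.

Lemma rate_qfree_count q u x : (0 < q)%N ->
  (fun n => (u n)%:R / n%:R) @ \oo --> x ->
  (fun n => (qfree_count q (u n))%:R / n%:R) @ \oo --> (1 - q%:R^-1) * x.
Proof.
move=> q0 ux.
rewrite (_ : (fun n => _) =
  (fun n => (u n)%:R / n%:R - (u n %/ q)%:R / n%:R)); last first.
  apply/funext => n; rewrite -mulrBl -[in (u n)%:R](qfree_count_div (u n) q0).
  by rewrite natrD addrK.
rewrite mulrBl mul1r mulrC; apply: cvgB => //.
exact: rate_divn.
Qed.

(** Up to an error K r^E / (1 - r), uniform in n, both sums can be cut at E,
    and a finite sum commutes with the limit. *)
Lemma tannery_geometric (F : nat -> nat -> R) (f S : nat -> R) (K r : R) :
  0 <= r < 1 -> 0 <= K ->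
  (forall n e, 0 <= F n e <= K * r ^+ e) ->
  (forall e, (fun n => F n e) @ \oo --> f e) ->
  (forall n, exists M, forall M', (M <= M')%N -> S n = \sum_(e < M') F n e) ->
  exists2 l : R, series f @ \oo --> l & S @ \oo --> l.
Proof.
move=> /andP[r0 r1] K0 Fb Ff SF.
have fb e : 0 <= f e <= K * r ^+ e.
  apply/andP; split.
    apply: (ler_cvg_to (cvg_cst (0 : R)) (Ff e)).
    by apply: nearW => n; case/andP: (Fb n e).
  apply: (ler_cvg_to (Ff e) (cvg_cst (K * r ^+ e : R))).
  by apply: nearW => n; case/andP: (Fb n e).
have f0 e : 0 <= f e by case/andP: (fb e).
have nr1 : `|r| < 1 by rewrite ger0_norm.
have r1' : 0 < 1 - r by rewrite subr_gt0.
have tail (g : nat -> R) E M : (forall e, 0 <= g e <= K * r ^+ e) ->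
    0 <= \sum_(E <= e < M) g e <= K * r ^+ E / (1 - r).
  move=> gb; apply/andP; split.
    by apply: sumr_ge0 => e _; case/andP: (gb e).
  apply: (@le_trans _ _ (\sum_(E <= e < M) K * r ^+ e)).
    by apply: ler_sum => e _; case/andP: (gb e).
  have [EM|/ltnW ME] := leqP E M; last first.
    by rewrite big_geq // !mulr_ge0 ?exprn_ge0 // invr_ge0 ltW.
  rewrite ler_pdivlMr //.
  have -> : (\sum_(E <= e < M) K * r ^+ e) * (1 - r) = K * (r ^+ E - r ^+ M).
    rewrite -mulr_sumr -mulrA; congr (_ * _).
    rewrite -[_ ^+ E - _]opprB -(telescope_sumr (fun e => r ^+ e) EM) -sumrN mulr_suml.
    by apply: eq_bigr => e _; rewrite exprS; ring.
  by rewrite ler_wpM2l // gerBl exprn_ge0.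
have cf : cvgn (series f).
  apply: (series_le_cvg f0 _ _ (is_cvg_geometric_series (a := K) nr1)) => e /=.
    by rewrite mulr_ge0 // exprn_ge0.
  by case/andP: (fb e).
exists (limn (series f)) => //.
apply/cvgrPdist_le => eps eps0.
have [E HE] : exists E, K * r ^+ E / (1 - r) <= eps / 2.
  have : (fun E => K * r ^+ E / (1 - r)) @ \oo --> K * 0 / (1 - r).
    apply: cvgM; last exact: cvg_cst.
    by apply: cvgM; [exact: cvg_cst|exact: cvg_expr].
  rewrite mulr0 mul0r => /cvgr_le /(_ (eps / 2)) h.
  have /h[E _ hE] : 0 < eps / 2 by rewrite divr_gt0.
  by exists E; apply: hE => /=.
have FE : (fun n => \sum_(e < E) F n e) @ \oo --> \sum_(e < E) f e.
  elim: (E) => [|E' IH].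
    rewrite big_ord0 (_ : (fun n => _) = fun=> 0); first exact: cvg_cst.
    by apply/funext => n; rewrite big_ord0.
  rewrite big_ord_recr /= (_ : (fun n => _) =
    fun n => \sum_(e < E') F n e + F n E'); first exact: cvgD.
  by apply/funext => n; rewrite big_ord_recr.
have lf : \sum_(e < E) f e <= limn (series f) <= \sum_(e < E) f e + eps / 2.
  apply/andP; split.
    rewrite -(big_mkord xpredT); apply: nondecreasing_cvgn_le => //.
    exact: nondecreasing_series.
  apply: limr_le => //; near=> n; rewrite /series /=.
  have En : (E <= n)%N by near: n; exact: nbhs_infty_ge.
  rewrite (big_cat_nat (leq0n E) En) //= big_mkord lerD2l.
  by case/andP: (tail f E n fb) => _ /le_trans; exact.
move/cvgrPdist_le : FE => /(_ (eps / 2)) FE.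
near=> n.
have FEn : `|\sum_(e < E) f e - \sum_(e < E) F n e| <= eps / 2.
  by near: n; apply: FE; rewrite divr_gt0.
have [M hM] := SF n.
rewrite (hM (maxn M E)) ?leq_maxl // -(big_mkord xpredT (F n)).
rewrite (big_cat_nat (leq0n E) (leq_maxr M E)) //= big_mkord.
have := tail (F n) E (maxn M E) (Fb n).
move: FEn lf; rewrite !ler_norml => /andP[? ?] /andP[? ?] /andP[? ?].
by apply/andP; split; lra.
Unshelve. all: by end_near. Qed.

End LinearGrowth.

(** * Weights as lengths of intervals *)

Lemma cvg_sum_seq (R : realType) (s : seq nat) (f : nat -> nat -> R) (l : nat -> R) :
  (forall t, t \in s -> f t @ \oo --> l t) ->
  (fun n => \sum_(t <- s) f t n) @ \oo --> \sum_(t <- s) l t.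
Proof.
elim: s => [|t s IH] fl.
  rewrite big_nil (_ : (fun n => _) = fun=> 0); first exact: cvg_cst.
  by apply/funext => n; rewrite big_nil.
rewrite big_cons (_ : (fun n => _) = fun n => f t n + \sum_(u <- s) f u n).
  by apply: cvgD; [|apply: IH => u us]; apply: fl; rewrite inE ?us ?eqxx ?orbT.
by apply/funext => n; rewrite big_cons.
Qed.

(** The i with a given number of levels form an interval. *)
Lemma lev_eq q N i r : (1 < q)%N -> (0 < i)%N ->
  (lev q N i == r) =
  (N %/ q ^ r < i)%N && ((r == 0%N) || (i <= N %/ q ^ r.-1)%N).
Proof.
move=> q1 i0.
have qn n : (0 < q ^ n)%N by rewrite expn_gt0 (ltnW q1).
rewrite eqn_leq; congr andb.
  by rewrite leqNgt ltn_lev // -ltnNge ltn_divLR // mulnC.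
by case: r => //= r; rewrite ltn_lev // leq_divRL // mulnC.
Qed.

Lemma qfree_count_widen q N V : (V <= N)%N ->
  qfree_count q V = (\sum_(i < N.+1) (~~ (q %| i) && (i <= V)))%N.
Proof.
move=> VN; rewrite /qfree_count.
rewrite (big_ord_widen N.+1 (fun i => nat_of_bool (~~ (q %| i)%N))) ?ltnS //.
rewrite big_mkcond; apply: eq_bigr => i _.
by rewrite ltnS; case: (i <= V)%N; rewrite ?andbT ?andbF.
Qed.

Lemma qfree_count_interval q N U V : (U <= V <= N)%N ->
  (\sum_(i < N.+1) (~~ (q %| i) && (U < i <= V)) + qfree_count q U
   = qfree_count q V)%N.
Proof.
move=> /andP[UV VN].
rewrite !(@qfree_count_widen q N) ?(leq_trans UV) // -big_split /=.
by apply: eq_bigr => i _; case: (~~ _) => //=; lia.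
Qed.

Lemma qfree_count_interval_ge q N U V : (U <= N)%N -> (V <= N)%N ->
  (qfree_count q V <=
   \sum_(i < N.+1) (~~ (q %| i) && (U < i <= V)) + qfree_count q U)%N.
Proof.
move=> UN VN.
rewrite !(@qfree_count_widen q N) // -big_split /=.
by apply: leq_sum => i _; case: (~~ _) => //=; lia.
Qed.

Section LengthRates.
Context {R : realType} {d : nat} {m : nat -> nat}.
Hypothesis d_ge2 : (2 <= d)%N.
Hypothesis m_step : forall k, (1 <= k < d)%N -> (m k.+1 <= m k)%N.
Hypothesis md_ge2 : (2 <= m d)%N.

Lemma rate_Lcomp k : (1 <= k <= d)%N ->
  (fun n => (Lcomp R m k n)%:R / n%:R) @ \oo --> (ln (m 1)%:R / ln (m k)%:R : R).
Proof.
elim: k => // k IH kd; have [->|k0] := posnP k.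
  rewrite divff ?gt_eqF ?(ln_m_gt0 (d := d)) //; last by lia.
  apply: cvg_near_cst; near=> n; rewrite /= divff // pnatr_eq0 -lt0n.
  by near: n; exact: nbhs_infty_gt.
have id : (2 <= k.+1 <= d)%N by lia.
have kd' : (1 <= k <= d)%N by lia.
have lk := @ln_m_gt0 R d m d_ge2 m_step md_ge2 k kd'.
have lk1 := @ln_m_gt0 R d m d_ge2 m_step md_ge2 k.+1 kd.
apply: (@rate_perturb _ (fun n => (Lcomp R m k n)%:R / gamma R m k.+1) _ 1).
  move=> n; rewrite LcompS // ler_norml.
  have := L_ge_div d_ge2 m_step md_ge2 (Lcomp R m k n) id (R := R).
  have := L_le_div d_ge2 m_step md_ge2 (Lcomp R m k n) id (R := R).
  by move=> ? ?; apply/andP; split; lra.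
rewrite (_ : (fun n => _) = fun n =>
  (Lcomp R m k n)%:R / n%:R / gamma R m k.+1); last first.
  by apply/funext => n; rewrite mulrAC.
rewrite (_ : ln _ / _ = ln (m 1)%:R / ln (m k)%:R / gamma R m k.+1); last first.
  by rewrite /gamma /=; field; rewrite !gt_eqF.
by apply: cvgM; [exact: IH|exact: cvg_cst].
Unshelve. all: by end_near. Qed.

Lemma gamma_prodE k : (1 <= k <= d)%N ->
  gamma_prod R d m k = ln (m d)%:R / ln (m k)%:R.
Proof.
move=> kd; have lk i := @ln_m_gt0 R d m d_ge2 m_step md_ge2 i.
rewrite /gamma_prod big_add1 /=; have [->|ne] := eqVneq k d.
  by rewrite big_geq // divff // gt_eqF // lk //; lia.
rewrite (telescope_prodf (f := fun i => ln (m i)%:R : R)) //; last by lia.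
by move=> i ikd; rewrite gt_eqF // lk //; lia.
Qed.

Lemma gamma_prod_d : gamma_prod R d m d = 1.
Proof. by rewrite /gamma_prod big_geq. Qed.

Lemma gamma_prod_gt0 k : (1 <= k <= d)%N -> 0 < gamma_prod R d m k.
Proof.
by move=> kd; rewrite gamma_prodE // divr_gt0 // (ln_m_gt0 (d := d)) //; lia.
Qed.

Lemma gamma_prod_homo k k' : (1 <= k <= k')%N -> (k' <= d)%N ->
  gamma_prod R d m k <= gamma_prod R d m k'.
Proof.
move=> kk k'd.
have lk := @ln_m_gt0 R d m d_ge2 m_step md_ge2 k.
have lk' := @ln_m_gt0 R d m d_ge2 m_step md_ge2 k'.
have ld := @ln_m_gt0 R d m d_ge2 m_step md_ge2 d.
have m1 := m_gt1 d_ge2 m_step md_ge2 (k := k').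
have mk := m_anti d_ge2 m_step md_ge2 kk k'd.
have kd : (1 <= k <= d)%N by lia.
have kd' : (1 <= k' <= d)%N by lia.
have dd : (1 <= d <= d)%N by lia.
rewrite !gamma_prodE // ler_wpM2l ?(ltW (ld dd)) // lef_pV2 ?posrE ?lk ?lk' //.
have := m1 kd' => m1'.
by rewrite ler_ln ?posrE ?ltr0n ?ler_nat //; lia.
Qed.

End LengthRates.

Section SortedRow.
Context {R : realType} {d q : nat} {m p : nat -> nat} {sigma : nat -> nat -> nat}.
Hypothesis hsigma : is_sorting R d q m p sigma.
Variable s : nat.
Hypothesis sd : (1 <= s <= d.-1)%N.

Lemma sigma_range t : (s <= t < d)%N -> (s <= sigma s t < d)%N.
Proof.
move=> td; have [pe _] := hsigma sd.
rewrite -mem_index_iota -(perm_mem pe); apply/mapP; exists t => //.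
by rewrite mem_index_iota.
Qed.

Lemma sigma_onto k : (s <= k < d)%N -> exists2 t, (s <= t < d)%N & sigma s t = k.
Proof.
have [pe _] := hsigma sd.
rewrite -mem_index_iota -(perm_mem pe) => /mapP[t].
by rewrite mem_index_iota => td ->; exists t.
Qed.

Lemma sigma_inj t t' : (s <= t < d)%N -> (s <= t' < d)%N ->
  sigma s t = sigma s t' -> t = t'.
Proof.
move=> td td' e; have [pe _] := hsigma sd.
have := iota_uniq s (d - s); rewrite -/(index_iota s d) -(perm_uniq pe) => un.
have nthE u : (s <= u < d)%N ->
    nth 0%N [seq sigma s t | t <- index_iota s d] (u - s) = sigma s u.
  move=> ud; rewrite (nth_map 0%N) ?size_iota; last by lia.
  by rewrite nth_iota; [congr sigma|]; lia.
have := e; rewrite -(nthE _ td) -(nthE _ td') => /eqP.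
by rewrite nth_uniq // ?size_map ?size_iota; lia.
Qed.

Lemma a_sigma_homo t t' : (s <= t <= t')%N -> (t' < d)%N ->
  a_ R d q m p (sigma s t) <= a_ R d q m p (sigma s t').
Proof.
move=> tt td; have [_ ord] := hsigma sd.
have [->//|ne] := eqVneq t t'.
by case: (ord t t') => [|||/ltW|[->]] //; lia.
Qed.

Lemma toggled t u : (s <= u < d)%N -> (t < d)%N ->
  (sigma s u \in [seq sigma s v | v <- index_iota s t.+1]) = (u <= t)%N.
Proof.
move=> ud td; apply/mapP/idP => [[v]|ut].
  rewrite mem_index_iota => vt e.
  by rewrite (sigma_inj ud _ e); lia.
by exists u => //; rewrite mem_index_iota; lia.
Qed.

End SortedRow.

Section Rates.
Context {R : realType} {d q : nat} {m : nat -> nat}.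
Hypotheses (d_ge2 : (2 <= d)%N) (q_gt1 : (1 < q)%N).
Hypothesis m_step : forall k, (1 <= k < d)%N -> (m k.+1 <= m k)%N.
Hypothesis md_ge2 : (2 <= m d)%N.
Variable p : nat -> nat.
Hypothesis hp : is_exponents R d q m p.

Local Notation a := (a_ R d q m p).

Lemma a_gt0 k : (1 <= k <= d.-1)%N -> 0 < a k.
Proof.
move=> kd; rewrite /a_ mulr_gt0 ?exprn_gt0 ?ltr0n ?(ltnW q_gt1) //.
by apply: gamma_prod_gt0 => //; lia.
Qed.

Lemma a_le1 k : (1 <= k <= d.-1)%N -> a k <= 1.
Proof.
move=> kd; have /andP[h _] := hp kd.
have g0 : 0 < gamma_prod R d m k by apply: gamma_prod_gt0 => //; lia.
by rewrite /a_ -ler_pdivlMr // mul1r.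
Qed.

Lemma qa_gt1 k : (1 <= k <= d.-1)%N -> 1 < q%:R * a k.
Proof.
move=> kd; have /andP[_ h] := hp kd.
have g0 : 0 < gamma_prod R d m k by apply: gamma_prod_gt0 => //; lia.
by rewrite /a_ mulrA -exprS -ltr_pdivrMr // mul1r.
Qed.

Lemma p_anti k k' : (1 <= k <= k')%N -> (k' <= d.-1)%N -> (p k' <= p k)%N.
Proof.
move=> kk kd.
have kd1 : (1 <= k <= d.-1)%N by lia.
have kd2 : (1 <= k' <= d.-1)%N by lia.
have /andP[_ h] := hp kd1; have /andP[h' _] := hp kd2.
have g0 : 0 < gamma_prod R d m k by apply: gamma_prod_gt0 => //; lia.
have g0' : 0 < gamma_prod R d m k' by apply: gamma_prod_gt0 => //; lia.
have gg : gamma_prod R d m k <= gamma_prod R d m k' by apply: gamma_prod_homo => //; lia.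
have : q%:R ^+ p k' < q%:R ^+ (p k).+1 :> R.
  by apply: le_lt_trans h' (le_lt_trans _ h); rewrite lef_pV2.
by rewrite -!natrX ltr_nat ltn_exp2l // ltnS.
Qed.

Variable sigma : nat -> nat -> nat.
Hypothesis hsigma : is_sorting R d q m p sigma.

(** Only the case p k = p k' is at stake. Then a k <= a k', so k is sorted
    before k'; for equal values this rests on ties being ordered by increasing
    index. *)
Lemma p_st_anti s t k k' : (1 <= s <= d.-1)%N -> (t < d)%N ->
  (s <= k <= k')%N -> (k' < d)%N ->
  (p_st p sigma s t k' <= p_st p sigma s t k)%N.
Proof.
move=> sd td kk kd.
have [u ud uk] : exists2 u, (s <= u < d)%N & sigma s u = k.
  by apply: (sigma_onto hsigma sd); lia.
have [u' ud' uk'] : exists2 u, (s <= u < d)%N & sigma s u = k'.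
  by apply: (sigma_onto hsigma sd); lia.
have pp : (p k' <= p k)%N by apply: p_anti; lia.
rewrite /p_st -uk -uk' !(toggled hsigma sd) //.
case: (leqP u' t) => u't; case: (leqP u t) => ut; rewrite uk uk'; try lia.
have [//|pe] := ltnP (p k') (p k).
have {}pe : p k = p k' by apply/eqP; rewrite eqn_leq pp pe.
have [_ ord] := hsigma sd.
have aa : a k <= a k'.
  rewrite /a_ pe ler_wpM2l ?exprn_ge0 //; apply: gamma_prod_homo => //; lia.
case: (ord u' u); rewrite ?uk ?uk'; try lia.
by rewrite ltNge aa.
Qed.


(** Let i be in the block N / q^e < i <= N / q^(e-1). The numbers of levels of
    its chain are those recorded by (s, t) when i q^e / N lies between the
    breakpoints t and t.+1. *)
Definition breakpoint (s t : nat) : R :=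
  if (t < s)%N then 1 else if (t < d)%N then q%:R * a (sigma s t) else q%:R.

(** The number of levels in the coordinate k that (s, t) records for a chain
    with e levels in the last coordinate. *)
Definition pattern (s t e k : nat) : nat :=
  if k == d then e else if (s <= k)%N then (e - p_st p sigma s t k)%N else 0%N.

(** A weight is the length of an interval between breakpoints, in units of N /
    q^e, times the density 1 - 1/q of the q-free integers. *)
Lemma delta_breakpoint e s t : (1 <= s <= d)%N -> (s.-1 <= t < d)%N ->
  delta R d q m p sigma e s t =
  (breakpoint s t.+1 - breakpoint s t) * (q%:R - 1) / q%:R ^+ e.+1.
Proof.
move=> sd td; rewrite /delta /breakpoint.
have q0 : q%:R != 0 :> R by rewrite pnatr_eq0 -lt0n ltnW.
have qe : q%:R ^+ e != 0 :> R by rewrite expf_neq0.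
have [sE|sE] := eqVneq s d.
  have -> : (t < s)%N by lia.
  have -> : (t.+1 < s)%N = false by lia.
  have -> : (t.+1 < d)%N = false by lia.
  by rewrite expr2.
have [tE|tE] := eqVneq t s.-1.
  have -> : (t < s)%N by lia.
  have -> : (t.+1 < s)%N = false by lia.
  have -> : (t.+1 < d)%N by lia.
  by rewrite tE prednK //; lia.
have -> : (t < s)%N = false by lia.
have -> : (t.+1 < s)%N = false by lia.
have -> : (t < d)%N by lia.
have [tE'|tE'] := eqVneq t d.-1.
  have -> : (t.+1 < d)%N = false by lia.
  by rewrite tE' exprS; field; rewrite qe q0.
have -> : (t.+1 < d)%N by lia.
by rewrite exprS; field; rewrite qe q0.
Qed.

Lemma sum_delta e s : (1 <= s <= d)%N ->
  \sum_(s.-1 <= t < d) delta R d q m p sigma e s t =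
  (q%:R - 1) ^+ 2 / q%:R ^+ e.+1.
Proof.
move=> sd.
rewrite (eq_big_nat _ _ (F2 := fun t =>
  (breakpoint s t.+1 - breakpoint s t) * ((q%:R - 1) / q%:R ^+ e.+1))); last first.
  by move=> t td; rewrite delta_breakpoint // mulrA.
rewrite -mulr_suml telescope_sumr; last by lia.
rewrite /breakpoint ltnn.
have -> : (d < s)%N = false by lia.
have -> : (s.-1 < s)%N by lia.
by rewrite expr2 mulrA.
Qed.

End Rates.

(** * The chains with a given number of levels *)

Section Block.
Context {R : realType} {d q : nat} {m : nat -> nat}.
Hypotheses (d_ge2 : (2 <= d)%N) (q_gt1 : (1 < q)%N).
Hypothesis m_step : forall k, (1 <= k < d)%N -> (m k.+1 <= m k)%N.
Hypothesis md_ge2 : (2 <= m d)%N.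

Local Notation N k n := (Lcomp R m k n).
Local Notation c := (ln (m 1)%:R / ln (m d)%:R : R).

Let q_gt0 : (0 < q)%N := ltnW q_gt1.
Let qR_gt0 : 0 < q%:R :> R. Proof. by rewrite ltr0n. Qed.
Let lnm_gt0 k : (1 <= k <= d)%N -> 0 < ln (m k)%:R :> R.
Proof. exact: (ln_m_gt0 d_ge2 m_step md_ge2). Qed.

Lemma rate_length_div k r : (1 <= k <= d)%N ->
  (fun n => (N k n %/ q ^ r)%:R / n%:R) @ \oo -->
  c * gamma_prod R d m k / (q ^ r)%:R.
Proof.
move=> kd; apply: rate_divn; first by rewrite expn_gt0 q_gt0.
rewrite (gamma_prodE d_ge2 m_step md_ge2) //.
rewrite (_ : c * _ = ln (m 1)%:R / ln (m k)%:R).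
  exact: (rate_Lcomp d_ge2 m_step md_ge2 kd).
have l1 := lnm_gt0 kd; have ld : 0 < ln (m d)%:R :> R by apply: lnm_gt0; lia.
by field; rewrite !gt_eqF.
Qed.

Variable e : nat.
Variables (mu : probability (Sigma d m) R) (Omega : set (Sigma d m)).
Hypotheses (closed_Omega : closed Omega) (mu_Omega : mu Omega = 1%E).

Local Notation ent := (entropy_nat mu Omega).
Local Notation K := (e%:R * ln #|{: letter d m}|%:R : R).

Definition block_entropy n : R :=
  \sum_(i < (N d n).+1 | ~~ (q %| i)%N && (lev q (N d n) i == e))
    ent (profile (R := R) (q := q) (m := m) n i).

Lemma block_entropy_bounds n i : ~~ (q %| i)%N -> lev q (N d n) i == e ->
  0 <= ent (profile (R := R) (q := q) (m := m) n i) <= K.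
Proof.
move=> qi /eqP ie; apply: (entropy_nat_bounds md_ge2 closed_Omega mu_Omega).
move=> l k; rewrite /levels /profile => lt; apply: leq_trans lt _.
rewrite -ie; apply: leq_lev; apply: (@Lcomp_leq R d) => //.
by have := ltn_ord k; lia.
Qed.

Hypothesis e_gt0 : (0 < e)%N.

Definition block_size n : nat :=
  \sum_(i < (N d n).+1) (~~ (q %| i) && (lev q (N d n) i == e)).

Lemma block_sizeE n :
  (block_size n + qfree_count q (N d n %/ q ^ e) =
   qfree_count q (N d n %/ q ^ e.-1))%N.
Proof.
rewrite -(@qfree_count_interval q (N d n) (N d n %/ q ^ e)
  (N d n %/ q ^ e.-1)); last first.
  by rewrite leq_div andbT leq_div2l ?expn_gt0 ?q_gt0 // leq_pexp2l // leq_pred.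
rewrite /block_size; congr (_ + _)%N; apply: eq_bigr => i _.
case: (boolP (q %| i)%N) => //= qi.
by rewrite lev_eq ?(qfree_gt0 qi) // (gtn_eqF e_gt0).
Qed.

Lemma rate_block_size :
  (fun n => (block_size n)%:R / n%:R) @ \oo -->
  (c * ((q%:R - 1) ^+ 2 / q%:R ^+ e.+1) : R).
Proof.
have dd : (1 <= d <= d)%N by lia.
have h r := rate_qfree_count q_gt0 (@rate_length_div d r dd).
rewrite (_ : (fun n => _) = fun n =>
  (qfree_count q (N d n %/ q ^ e.-1))%:R / n%:R -
  (qfree_count q (N d n %/ q ^ e))%:R / n%:R); last first.
  by apply/funext => n; rewrite -block_sizeE natrD -mulrBl addrK.
have qe : q%:R ^+ e.-1 != 0 :> R by rewrite expf_neq0 // gt_eqF.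
rewrite (_ : c * _ = (1 - q%:R^-1) * (c * gamma_prod R d m d / (q ^ e.-1)%:R) -
   (1 - q%:R^-1) * (c * gamma_prod R d m d / (q ^ e)%:R)).
  by apply: cvgB; exact: h.
have eE : q%:R ^+ e = q%:R * q%:R ^+ e.-1 :> R by rewrite -exprS prednK.
rewrite gamma_prod_d !natrX [q%:R ^+ e.+1]exprS eE.
by field; rewrite ?qe ?gt_eqF //; apply: lnm_gt0; lia.
Qed.

(** Divided by N this bound is independent of n and summable over e: it is the
    majorant for the sum over the blocks. *)
Lemma block_entropy_bound n :
  0 <= block_entropy n <= (N d n)%:R / q%:R ^+ e.-1 * K.
Proof.
apply/andP; split.
  by apply: sumr_ge0 => i /andP[qi ie]; case/andP: (block_entropy_bounds qi ie).
have K0 : 0 <= K.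
  by rewrite mulr_ge0 // ln_ge0 // ler1n; apply/card_gt0P; exists point.
apply: (@le_trans _ _ ((block_size n)%:R * K)).
  rewrite /block_entropy /block_size natr_sum mulr_suml big_mkcond.
  apply: ler_sum => i _; case: ifP => [/andP[qi ie]|_]; last by rewrite mul0r.
  by rewrite mul1r; case/andP: (block_entropy_bounds qi ie).
rewrite ler_wpM2r // ler_pdivlMr ?exprn_gt0 // -natrX -natrM ler_nat.
rewrite -leq_divRL ?expn_gt0 ?q_gt0 //.
rewrite -[leqRHS](qfree_count_div _ q_gt0) -block_sizeE -addnA.
exact: leq_addr.
Qed.

End Block.

Section BlockLimit.
Context {R : realType} {d q : nat} {m : nat -> nat}.
Hypotheses (d_ge2 : (2 <= d)%N) (q_gt1 : (1 < q)%N).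
Hypothesis m_step : forall k, (1 <= k < d)%N -> (m k.+1 <= m k)%N.
Hypothesis md_ge2 : (2 <= m d)%N.
Variable p : nat -> nat.
Hypothesis hp : is_exponents R d q m p.
Variable sigma : nat -> nat -> nat.
Hypothesis hsigma : is_sorting R d q m p sigma.
Variables (s e : nat).
Hypotheses (sd : (1 <= s <= d)%N) (e_gt0 : (0 < e)%N).
Hypothesis s_first : forall k, (1 <= k <= d.-1)%N -> (s <= k)%N = (p k < e)%N.

Local Notation N k n := (Lcomp R m k n).
Local Notation a := (a_ R d q m p).
Local Notation beta := (@breakpoint R d q m p sigma s).
Local Notation rho := (pattern (d := d) p sigma s).
Local Notation c := (ln (m 1)%:R / ln (m d)%:R : R).

Let q_gt0 : (0 < q)%N := ltnW q_gt1.
Let qR_gt0 : 0 < q%:R :> R. Proof. by rewrite ltr0n. Qed.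
Let qR_ge1 : 1 <= q%:R :> R. Proof. by rewrite ler1n. Qed.
Let lnm_gt0 k : (1 <= k <= d)%N -> 0 < ln (m k)%:R :> R.
Proof. exact: (ln_m_gt0 d_ge2 m_step md_ge2). Qed.
Let c_gt0 : 0 < c. Proof. by rewrite divr_gt0 // lnm_gt0; lia. Qed.

Let a_gp k : gamma_prod R d m k = a k / q%:R ^+ p k.
Proof. by rewrite /a_ mulrAC divff ?mul1r // expf_neq0 // gt_eqF. Qed.

Let mid k : (s <= k)%N -> (k < d)%N -> (1 <= s <= d.-1)%N /\ (1 <= k <= d.-1)%N.
Proof. lia. Qed.

Lemma rho_e t k : (rho t e k <= e)%N.
Proof. by rewrite /pattern; case: ifP => // _; case: ifP => // _; rewrite leq_subr. Qed.

Let beta_ge1 t : 1 <= beta t.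
Proof.
rewrite /breakpoint; case: ltnP => // st; case: ltnP => // td.
have [sd' _] := mid st td.
apply: ltW; apply: (qa_gt1 d_ge2 q_gt1 m_step md_ge2 hp).
by have := sigma_range hsigma sd' (t := t); lia.
Qed.

Let beta_leq t : beta t <= q%:R.
Proof.
rewrite /breakpoint; case: ltnP => // st; case: ltnP => // td.
have [sd' _] := mid st td.
rewrite ler_piMr // ?ler0n //; apply: (a_le1 d_ge2 q_gt1 m_step md_ge2 hp).
by have := sigma_range hsigma sd' (t := t); lia.
Qed.

(** In units of N / q^e, a coordinate k = sigma s u with u <= t has its lower
    threshold at q a_k, which sorting places at most at the breakpoint t; all
    other coordinates have it at most at 1. *)
Lemma lower_threshold t k : (s.-1 <= t < d)%N -> (1 <= k <= d)%N ->
  gamma_prod R d m k / (q ^ rho t e k)%:R <= beta t / q%:R ^+ e.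
Proof.
move=> td kd; rewrite /pattern natrX.
have qe n : 0 < q%:R ^+ n :> R by rewrite exprn_gt0.
have [->|kne] := eqVneq k d.
  by rewrite gamma_prod_d ler_wpM2r ?invr_ge0 ?(ltW (qe _)).
have kd' : (1 <= k <= d.-1)%N by lia.
have a1 := a_le1 d_ge2 q_gt1 m_step md_ge2 hp kd'.
have a0 := a_gt0 (R := R) d_ge2 q_gt1 m_step md_ge2 p kd'.
case: leqP => [sk|ks]; last first.
  have pe : (e <= p k)%N by have := s_first kd'; lia.
  rewrite expr0 divr1 a_gp.
  apply: ler_pM; first exact: ltW.
  - by rewrite invr_ge0 ltW.
  - exact: le_trans a1 (beta_ge1 t).
  - by rewrite lef_pV2 ?posrE // ler_eXn2l // ltr1n.
have sd' : (1 <= s <= d.-1)%N by lia.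
have pe : (p k < e)%N by rewrite -s_first.
have [|u ud uk] := sigma_onto hsigma sd' (k := k); first by lia.
rewrite /p_st -uk (toggled hsigma sd') //; last by lia.
rewrite uk a_gp -mulrA -invfM -exprD.
case: leqP => ut.
  rewrite (_ : (p k + (e - (p k).+1) = e.-1)%N); last by lia.
  rewrite -[in X in _ <= X](prednK e_gt0) exprS invfM mulrA.
  rewrite ler_wpM2r ?invr_ge0 ?(ltW (qe _)) //.
  rewrite ler_pdivlMr // mulrC /breakpoint.
  have -> : (t < s)%N = false by lia.
  have -> : (t < d)%N by lia.
  rewrite ler_wpM2l ?(ltW qR_gt0) // -uk.
  by apply: (a_sigma_homo hsigma sd'); lia.
rewrite (_ : (p k + (e - p k) = e)%N); last by lia.
by rewrite ler_wpM2r ?invr_ge0 ?(ltW (qe _)) // (le_trans a1).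
Qed.

(** In the same units, a coordinate k = sigma s u with u > t has its upper
    threshold at q a_k, which sorting places at least at the breakpoint t.+1;
    the coordinates with u <= t have it at q^2 a_k > q, and the last
    coordinate has it at q. *)
Lemma upper_threshold t k : (s.-1 <= t < d)%N -> (1 <= k <= d)%N ->
  rho t e k != 0%N ->
  beta t.+1 / q%:R ^+ e <= gamma_prod R d m k / (q ^ (rho t e k).-1)%:R.
Proof.
move=> td kd; rewrite /pattern natrX.
have qe n : 0 < q%:R ^+ n :> R by rewrite exprn_gt0.
have qE x : x / q%:R ^+ e = x / q%:R / q%:R ^+ e.-1 :> R.
  by rewrite -{1}(prednK e_gt0) exprS invfM mulrA.
have [->|kne] := eqVneq k d.
  move=> _; rewrite gamma_prod_d qE ler_wpM2r ?invr_ge0 ?(ltW (qe _)) //.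
  by rewrite ler_pdivrMr // mul1r.
have kd' : (1 <= k <= d.-1)%N by lia.
have qa1 := qa_gt1 d_ge2 q_gt1 m_step md_ge2 hp kd'.
case: leqP => [sk|//].
have sd' : (1 <= s <= d.-1)%N by lia.
have pe : (p k < e)%N by rewrite -s_first.
have [|u ud uk] := sigma_onto hsigma sd' (k := k); first by lia.
rewrite /p_st -uk (toggled hsigma sd') //; last by lia.
rewrite uk a_gp -mulrA -invfM -exprD.
case: leqP => ut ne.
  have -> : (p k + (e - (p k).+1).-1 = e.-2)%N by lia.
  have e2 : (e.-2.+1 = e.-1)%N by lia.
  rewrite qE -e2 exprS invfM [in leLHS]mulrA ler_wpM2r ?invr_ge0 ?(ltW (qe _)) //.
  rewrite !ler_pdivrMr // (le_trans (beta_leq _)) //.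
  by rewrite ler_peMl // mulrC ltW.
rewrite (_ : (p k + (e - p k).-1 = e.-1)%N); last by lia.
rewrite qE ler_wpM2r ?invr_ge0 ?(ltW (qe _)) // ler_pdivrMr // mulrC /breakpoint.
have -> : (t.+1 < s)%N = false by lia.
have -> : (t.+1 < d)%N by lia.
rewrite ler_wpM2l ?(ltW qR_gt0) // -uk.
by apply: (a_sigma_homo hsigma sd'); lia.
Qed.

(** For a given n the thresholds need not be sorted as their limits are, hence
    the maximum here and the minimum below. *)
Definition lower t n : nat :=
  \max_(k <- index_iota 1 d.+1) (N k n %/ q ^ rho t e k)%N.

Definition upper t n : nat :=
  \big[minn/(N d n %/ q ^ e.-1)%N]_(k <- index_iota 1 d.+1 | rho t e k != 0%N)
    (N k n %/ q ^ (rho t e k).-1)%N.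

(** Nonpositive when the two thresholds are in the wrong order; in all cases a
    lower bound for the number of chains with the pattern (s, t). *)
Definition count_bound t n : R :=
  (qfree_count q (upper t n))%:R - (qfree_count q (lower t n))%:R.

Lemma rate_count_bound t : (s.-1 <= t < d)%N ->
  exists2 x : R, (fun n => count_bound t n / n%:R) @ \oo --> x
               & c * delta R d q m p sigma e s t <= x.
Proof.
move=> td.
have qe n : 0 < q%:R ^+ n :> R by rewrite exprn_gt0.
have [x lx xle] : exists2 x : R,
    (fun n => (lower t n)%:R / n%:R) @ \oo --> x & x <= c * (beta t / q%:R ^+ e).
  apply: (rate_bigmaxn_le (u := fun k n => (N k n %/ q ^ rho t e k)%N)).
    apply: mulr_ge0; first exact: ltW.
    apply: divr_ge0; last exact: ltW.
    exact: le_trans (beta_ge1 t).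
  move=> k; rewrite mem_index_iota => kd.
  exists (c * gamma_prod R d m k / (q ^ rho t e k)%:R); first exact: rate_length_div.
  by rewrite -mulrA ler_wpM2l ?(ltW c_gt0) // lower_threshold.
have [y uy yge] : exists2 y : R,
    (fun n => (upper t n)%:R / n%:R) @ \oo --> y & c * (beta t.+1 / q%:R ^+ e) <= y.
  apply: (rate_bigminn_ge (P := fun k => rho t e k != 0%N)
    (u := fun k n => (N k n %/ q ^ (rho t e k).-1)%N)).
    have dd : (1 <= d <= d)%N by lia.
    have re : rho t e d = e by rewrite /pattern eqxx.
    exists (c * gamma_prod R d m d / (q ^ e.-1)%:R); first exact: rate_length_div.
    rewrite -[leRHS]mulrA ler_wpM2l ?(ltW c_gt0) // -[in X in _ <= X]re.
    rewrite upper_threshold //.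
    by rewrite re -lt0n.
  move=> k; rewrite mem_index_iota => kd rk.
  exists (c * gamma_prod R d m k / (q ^ (rho t e k).-1)%:R); first exact: rate_length_div.
  by rewrite -[leRHS]mulrA ler_wpM2l ?(ltW c_gt0) // upper_threshold.
exists ((1 - q%:R^-1) * y - (1 - q%:R^-1) * x).
  rewrite (_ : (fun n => _) = fun n => (qfree_count q (upper t n))%:R / n%:R -
     (qfree_count q (lower t n))%:R / n%:R); last first.
    by apply/funext => n; rewrite -mulrBl.
  by apply: cvgB; apply: rate_qfree_count.
have -> : c * delta R d q m p sigma e s t =
   (1 - q%:R^-1) * (c * (beta t.+1 / q%:R ^+ e) - c * (beta t / q%:R ^+ e)).
  rewrite (delta_breakpoint d_ge2 q_gt1) // exprS; move: (qe e) => h.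
  by field; rewrite ?gt_eqF //; apply: lnm_gt0; lia.
rewrite -[leRHS]mulrBr ler_wpM2l //; first by rewrite subr_ge0 invf_le1.
by apply: lerB.
Qed.

Definition good t n i : bool :=
  all (fun k => lev q (N k n) i == rho t e k) (index_iota 1 d.+1).

Definition good_size t n : nat :=
  \sum_(i < (N d n).+1) (~~ (q %| i) && good t n i).

Lemma count_bound_le t n : count_bound t n <= (good_size t n)%:R.
Proof.
rewrite /count_bound lerBlDr -natrD ler_nat.
have Nd k : (1 <= k <= d)%N -> (N k n <= N d n)%N.
  by move=> kd; apply: (@Lcomp_leq R d) => //; lia.
apply: leq_trans (@qfree_count_interval_ge q (N d n) (lower t n) (upper t n) _ _) _.
- rewrite /lower big_seq; elim/big_ind: _ => // [x y xN yN|k].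
    by rewrite geq_max xN.
  by rewrite mem_index_iota => kd; exact: leq_trans (leq_div _ _) (Nd _ kd).
- rewrite /upper big_seq_cond; elim/big_ind: _ => // [|x y xN yN|k].
  + exact: leq_div.
  + by rewrite geq_min xN.
  + by rewrite mem_index_iota => /andP[kd _]; exact: leq_trans (leq_div _ _) (Nd _ kd).
rewrite leq_add2r; apply: leq_sum => i _.
case: (boolP (q %| i)%N) => //= qi.
case: (boolP (_ < _ <= _)%N) => // /andP[lo hi].
suff -> : good t n i by [].
apply/allP => k; rewrite mem_index_iota => kd.
rewrite lev_eq ?(qfree_gt0 qi) //; apply/andP; split.
  apply: leq_ltn_trans lo; rewrite /lower.
  by apply: (leq_bigmax_seq (F := fun k => (N k n %/ q ^ rho t e k)%N));
    rewrite ?mem_index_iota.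
have [//|nz] := eqVneq; rewrite /=.
apply: leq_trans hi _; rewrite /upper.
have : k \in index_iota 1 d.+1 by rewrite mem_index_iota.
elim: (index_iota 1 d.+1) => // j l IH; rewrite inE big_cons => /orP[/eqP <-|/IH le].
  by rewrite nz geq_minl.
by case: ifP => // _; rewrite geq_min le orbT.
Qed.

Lemma good_block t n i : good t n i -> lev q (N d n) i == e.
Proof.
move=> /allP /(_ d); rewrite mem_index_iota => /(_ ltac:(lia)).
by rewrite /pattern eqxx.
Qed.

Lemma good_unique t t' n i : (s.-1 <= t < d)%N -> (s.-1 <= t' < d)%N ->
  good t n i -> good t' n i -> t = t'.
Proof.
wlog tt : t t' / (t < t')%N.
  move=> H td td' g g'; have [lt|gt|//] := ltngtP t t'; first exact: H.
  by apply/esym; exact: H.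
move=> td td' /allP g /allP g'.
have sd' : (1 <= s <= d.-1)%N by lia.
have t's : (s <= t' < d)%N by lia.
have kr := sigma_range hsigma sd' t's.
have kI : sigma s t' \in index_iota 1 d.+1 by rewrite mem_index_iota; lia.
have := g _ kI; rewrite (eqP (g' _ kI)) /pattern.
have -> : (sigma s t' == d) = false by lia.
have -> : (s <= sigma s t')%N by lia.
rewrite /p_st !(toggled hsigma sd' t's) ?leqnn; try lia.
have -> : (t' <= t)%N = false by lia.
have := s_first (k := sigma s t'); lia.
Qed.

Variables (mu : probability (Sigma d m) R) (Omega : set (Sigma d m)).
Hypotheses (closed_Omega : closed Omega) (mu_Omega : mu Omega = 1%E).
Hypothesis Omega_neq0 : Omega !=set0.

Local Notation ent := (entropy_nat mu Omega).
Local Notation block_entropy := (@block_entropy R d q m e mu Omega).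
Local Notation block_size := (@block_size R d q m e).

Let K : R := e%:R * ln #|{: letter d m}|%:R.
Let h t := ent (rho t e).

Let h_bounds t : 0 <= h t <= K.
Proof.
apply: (entropy_nat_bounds md_ge2 closed_Omega mu_Omega).
by move=> l k lt; exact: leq_trans lt (rho_e t _).
Qed.

Lemma entropy_nat_joined t : (s.-1 <= t < d)%N ->
  h t = ln (m d)%:R * entropy mu (joined_alpha Omega p sigma s t e).
Proof.
move=> td; rewrite /h /entropy_nat; congr (_ * entropy mu _); apply/esym.
apply: joined_alpha_levels => //.
- move=> k k' kk kd'; apply: (p_st_anti d_ge2 q_gt1 m_step md_ge2 hp hsigma) => //; lia.
- by rewrite /pattern eqxx.
- move=> k kd; rewrite /pattern; have -> : (k == d) = false by lia.
  by have -> : (s <= k)%N by lia.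
- move=> k ks kd; rewrite /pattern; have -> : (k == d) = false by lia.
  by have -> : (s <= k)%N = false by lia.
Qed.

Lemma good_entropy t n i : good t n i ->
  ent (profile (R := R) (q := q) (m := m) n i) = h t.
Proof.
move=> /allP g; rewrite /h /entropy_nat; congr (_ * entropy mu _).
apply: eq_classes => l k; rewrite /levels /profile (eqP (g _ _)) //.
by rewrite mem_index_iota; have := ltn_ord k; lia.
Qed.

(** At most one pattern fits i, so the entropy of its chain lies between the
    sum of the contributions of the patterns and this sum corrected by the a
    priori bound K on what the patterns miss. *)
Lemma good_sandwich n i : ~~ (q %| i)%N -> lev q (N d n) i == e ->
  let y := ent (profile (R := R) (q := q) (m := m) n i) in
  \sum_(s.-1 <= t < d) (good t n i)%:R * h t <= y /\
  y <= K + \sum_(s.-1 <= t < d) (good t n i)%:R * (h t - K).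
Proof.
move=> qi ie y.
have /andP[y0 yK] := block_entropy_bounds d_ge2 q_gt1 m_step md_ge2
  closed_Omega mu_Omega qi ie.
have [[t td g]|ng] := pselect (exists2 t, (s.-1 <= t < d)%N & good t n i).
  have one (f : nat -> R) : \sum_(s.-1 <= u < d) (good u n i)%:R * f u = f t.
    rewrite (bigD1_seq t) /= ?iota_uniq ?mem_index_iota // g mul1r.
    rewrite big_seq_cond big1 ?addr0 // => u; rewrite mem_index_iota => /andP[ud ut].
    have [gu|] := boolP (good u n i); last by rewrite mul0r.
    by move: ut; rewrite (good_unique ud td gu g) eqxx.
  by rewrite !one /y (good_entropy g) addrCA subrr addr0.
have zero (f : nat -> R) : \sum_(s.-1 <= u < d) (good u n i)%:R * f u = 0.
  rewrite big_seq big1 // => u; rewrite mem_index_iota => ud.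
  have [gu|] := boolP (good u n i); last by rewrite mul0r.
  by case: ng; exists u.
by rewrite !zero addr0.
Qed.

Lemma sum_good n (f : nat -> R) :
  \sum_(i < (N d n).+1 | ~~ (q %| i)%N && (lev q (N d n) i == e))
    \sum_(s.-1 <= t < d) (good t n i)%:R * f t =
  \sum_(s.-1 <= t < d) (good_size t n)%:R * f t.
Proof.
rewrite exchange_big /=; apply: eq_bigr => t _.
rewrite -mulr_suml; congr (_ * _); rewrite /good_size natr_sum big_mkcond /=.
apply: eq_bigr => i _; case: (boolP (q %| i)%N) => //= qi.
case: ifP => // /negbT; apply: contraNeq => /eqP.
by case: (boolP (good t n i)) => // /good_block.
Qed.

Lemma block_entropy_ge n :
  \sum_(s.-1 <= t < d) count_bound t n * h t <= block_entropy n.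
Proof.
apply: (@le_trans _ _ (\sum_(s.-1 <= t < d) (good_size t n)%:R * h t)).
  apply: ler_sum => t _; have /andP[h0 _] := h_bounds t.
  by rewrite ler_wpM2r // count_bound_le.
rewrite -sum_good; apply: ler_sum => i /andP[qi ie].
by have [] := good_sandwich qi ie.
Qed.

Lemma block_entropy_le n :
  block_entropy n <= K * (block_size n)%:R +
    \sum_(s.-1 <= t < d) count_bound t n * (h t - K).
Proof.
apply: (@le_trans _ _ (K * (block_size n)%:R +
    \sum_(s.-1 <= t < d) (good_size t n)%:R * (h t - K))); last first.
  rewrite lerD2l; apply: ler_sum => t _; have /andP[_ hK] := h_bounds t.
  by rewrite ler_wnM2r ?subr_le0 // count_bound_le.
rewrite -sum_good /block_size natr_sum mulr_sumr.
rewrite (_ : \sum_(i < _) K * _ =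
  \sum_(i < (N d n).+1 | ~~ (q %| i)%N && (lev q (N d n) i == e)) K); last first.
  rewrite [RHS]big_mkcond /=; apply: eq_bigr => i _.
  by case: ifP; rewrite ?mulr1 ?mulr0.
rewrite -big_split /=; apply: ler_sum => i /andP[qi ie].
by have [] := good_sandwich qi ie.
Qed.

(** The lower and upper bounds of the block entropy have rates lo and hi with
    L <= lo <= hi <= L, where L is the claimed rate: the outer inequalities
    come from the thresholds, and the last one also uses that the weights add
    up to the density of the block. In particular the chains that fit no
    pattern are negligible. *)
Lemma rate_block_entropy :
  (fun n => block_entropy n / n%:R) @ \oo -->
  (ln (m 1)%:R * Htilde q Omega mu p sigma s e : R).
Proof.
have lmd : 0 < ln (m d)%:R :> R by apply: lnm_gt0; lia.
have -> : ln (m 1)%:R * Htilde q Omega mu p sigma s e =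
    \sum_(s.-1 <= t < d) c * delta R d q m p sigma e s t * h t.
  rewrite /Htilde mulr_sumr; apply: eq_big_nat => t td.
  by rewrite entropy_nat_joined //; field; rewrite gt_eqF.
set L := \sum_(_ <= _ < _) _.
have /choice[g gP] : forall t, exists g : R, (s.-1 <= t < d)%N ->
    (fun n => count_bound t n / n%:R) @ \oo --> g /\
    c * delta R d q m p sigma e s t <= g.
  move=> t; have [td|] := boolP (s.-1 <= t < d)%N; last by exists 0.
  by have [g] := rate_count_bound td; exists g.
have sums (f : nat -> R) :
    (fun n => \sum_(s.-1 <= t < d) count_bound t n / n%:R * f t) @ \oo -->
    \sum_(s.-1 <= t < d) g t * f t.
  apply: cvg_sum_seq => t; rewrite mem_index_iota => td.
  by apply: cvgM; [case: (gP t td)|exact: cvg_cst].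
have lo n : \sum_(s.-1 <= t < d) count_bound t n / n%:R * h t <=
    block_entropy n / n%:R.
  under eq_bigr do rewrite mulrAC.
  by rewrite -mulr_suml ler_wpM2r ?invr_ge0 ?ler0n ?block_entropy_ge.
have hi n : block_entropy n / n%:R <= K * ((block_size n)%:R / n%:R) +
    \sum_(s.-1 <= t < d) count_bound t n / n%:R * (h t - K).
  under eq_bigr do rewrite mulrAC.
  by rewrite -mulr_suml mulrA -mulrDl ler_wpM2r ?invr_ge0 ?ler0n ?block_entropy_le.
have chi : (fun n => K * ((block_size n)%:R / n%:R) +
    \sum_(s.-1 <= t < d) count_bound t n / n%:R * (h t - K)) @ \oo -->
    (K * (c * ((q%:R - 1) ^+ 2 / q%:R ^+ e.+1)) +
     \sum_(s.-1 <= t < d) g t * (h t - K) : R).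
  apply: cvgD => //; apply: cvgM; first exact: cvg_cst.
  exact: (rate_block_size d_ge2 q_gt1 m_step md_ge2 e_gt0).
have lohi : \sum_(s.-1 <= t < d) g t * h t <=
    K * (c * ((q%:R - 1) ^+ 2 / q%:R ^+ e.+1)) +
    \sum_(s.-1 <= t < d) g t * (h t - K).
  apply: (ler_cvg_to (sums h) chi); apply: nearW => n.
  exact: le_trans (lo n) (hi n).
have Llo : L <= \sum_(s.-1 <= t < d) g t * h t.
  rewrite /L !big_seq; apply: ler_sum => t; rewrite mem_index_iota => td.
  have /andP[h0 _] := h_bounds t.
  by rewrite ler_wpM2r //; case: (gP t td).
have hiL : K * (c * ((q%:R - 1) ^+ 2 / q%:R ^+ e.+1)) +
     \sum_(s.-1 <= t < d) g t * (h t - K) <= L.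
  rewrite -(sum_delta d_ge2 q_gt1 md_ge2 p sigma e sd) !mulr_sumr -big_split /=.
  rewrite /L !big_seq; apply: ler_sum => t; rewrite mem_index_iota => td.
  have /andP[_ hK] := h_bounds t; have [_ cg] := gP t td.
  rewrite -subr_le0 in hK.
  have := ler_wnM2r hK cg; lra.
have loE : \sum_(s.-1 <= t < d) g t * h t = L.
  by apply/eqP; rewrite eq_le Llo (le_trans lohi).
have hiE : K * (c * ((q%:R - 1) ^+ 2 / q%:R ^+ e.+1)) +
     \sum_(s.-1 <= t < d) g t * (h t - K) = L.
  by apply/eqP; rewrite eq_le hiL (le_trans Llo).
apply: (@squeeze_cvgr _ _ _ _
  (fun n => \sum_(s.-1 <= t < d) count_bound t n / n%:R * h t)
  (fun n => K * ((block_size n)%:R / n%:R) +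
    \sum_(s.-1 <= t < d) count_bound t n / n%:R * (h t - K))).
- by apply: nearW => n; rewrite lo hi.
- by rewrite -loE.
- by rewrite -hiE.
Qed.

End BlockLimit.

(** * The dimension *)

Section Assembly.
Context {R : realType} {d q : nat} {m : nat -> nat}.
Hypotheses (d_ge2 : (2 <= d)%N) (q_gt1 : (1 < q)%N).
Hypothesis m_step : forall k, (1 <= k < d)%N -> (m k.+1 <= m k)%N.
Hypothesis md_ge2 : (2 <= m d)%N.
Variable p : nat -> nat.
Hypothesis hp : is_exponents R d q m p.
Variable sigma : nat -> nat -> nat.
Hypothesis hsigma : is_sorting R d q m p sigma.
Variables (mu : probability (Sigma d m) R) (Omega : set (Sigma d m)).
Hypotheses (closed_Omega : closed Omega) (mu_Omega : mu Omega = 1%E).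
Hypothesis Omega_neq0 : Omega !=set0.

(** Asymptotically, the first coordinate in which some of the chains with e
    levels in the last coordinate have a level. It is the index s of the
    weights that apply to these chains. *)
Definition first_coordinate (e : nat) : nat :=
  (find (fun k => p k.+1 < e)%N (iota 0 d.-1)).+1.

Lemma first_coordinate_range e : (1 <= first_coordinate e <= d)%N.
Proof.
rewrite /first_coordinate /=.
have := find_size (fun k => p k.+1 < e)%N (iota 0 d.-1).
by rewrite size_iota; lia.
Qed.

Lemma first_coordinateP e k : (1 <= k <= d.-1)%N ->
  (first_coordinate e <= k)%N = (p k < e)%N.
Proof.
move=> kd; rewrite /first_coordinate.
set P := (fun k => p k.+1 < e)%N; set j := find P _.
have [jk|kj] := ltnP j k.
  have hasP : has P (iota 0 d.-1) by rewrite has_find size_iota -/j; lia.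
  have := nth_find 0%N hasP; rewrite -/j nth_iota ?add0n /P; last by lia.
  move=> lt; apply/esym; apply: leq_ltn_trans lt.
  by apply: (p_anti d_ge2 q_gt1 m_step md_ge2 hp); lia.
have := @before_find _ 0%N P (iota 0 d.-1) k.-1; rewrite -/j nth_iota; last by lia.
by rewrite add0n /P prednK; [move=> ->; lia|lia].
Qed.

Lemma first_coordinate_unique e s : (1 <= s <= d)%N ->
  (forall k, (1 <= k <= d.-1)%N -> (s <= k)%N = (p k < e)%N) ->
  first_coordinate e = s.
Proof.
move=> sd sP; have fd := first_coordinate_range e.
have [lt|gt|//] := ltngtP (first_coordinate e) s.
  have kd : (1 <= first_coordinate e <= d.-1)%N by lia.
  by have := sP _ kd; rewrite -first_coordinateP // leqnn; lia.
have kd : (1 <= s <= d.-1)%N by lia.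
by have := sP _ kd; rewrite -first_coordinateP // leqnn; lia.
Qed.

Definition block_rate (e : nat) : R :=
  if e is 0 then 0 else Htilde q Omega mu p sigma (first_coordinate e) e.

Local Notation B e n := (@block_entropy R d q m e mu Omega n).

Lemma block_entropy0 n : B 0 n = 0.
Proof.
rewrite /block_entropy big1 // => i /andP[qi /eqP l0].
have i0 := qfree_gt0 qi.
have : (0 < lev q (Lcomp R m d n) i)%N.
  by rewrite ltn_lev // mul1n -ltnS ltn_ord.
by rewrite l0.
Qed.

Lemma mean_info_blocks n M : (lev q (Lcomp R m d n) 1 < M)%N ->
  mean_info (q := q) mu Omega n = \sum_(e < M) B e n.
Proof.
move=> lM; rewrite /mean_info /block_entropy.
under [RHS]eq_bigr do rewrite big_mkcondr.
rewrite exchange_big /=; apply: eq_bigr => i qi.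
have lt : (lev q (Lcomp R m d n) i < M)%N.
  by apply: leq_ltn_trans lM; apply: leq_lev1 => //; exact: qfree_gt0 qi.
rewrite (bigD1 (Ordinal lt)) //= eqxx big1 ?addr0 // => e ne.
by rewrite ifN //; apply: contra_neq ne => /esym e_lev; apply: val_inj.
Qed.

Lemma le_pow_three_halves e : e%:R <= 2 * (3 / 2) ^+ e :> R.
Proof.
have h k : 1 <= (3 / 2) ^+ k :> R by apply: exprn_ege1; lra.
elim: e => [|e IH]; first by rewrite expr0; lra.
by rewrite -natr1 exprS; have := h e; lra.
Qed.

(** The chains are grouped by their number e of levels in the last coordinate.
    The contribution of the group e is at most a multiple of n e / q^e, so
    limits and the sum over e can be exchanged. *)
Lemma mean_info_rate : exists2 D : R,
  series block_rate @ \oo --> D &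
  (fun n => mean_info (q := q) mu Omega n / n%:R) @ \oo --> ln (m 1)%:R * D.
Proof.
have lm1 : 0 < ln (m 1)%:R :> R by apply: (ln_m_gt0 d_ge2 m_step md_ge2); lia.
have [|C NC] := @Lcomp_linear R d m d_ge2 m_step md_ge2 d; first by lia.
set lM : R := ln #|{: letter d m}|%:R.
have lM0 : 0 <= lM.
  by rewrite ln_ge0 // ler1n; apply/card_gt0P; exists point.
have q0 : 0 < q%:R :> R by rewrite ltr0n ltnW.
(* The ratio 3 / 4 absorbs the factor e, as e <= 2 * (3 / 2) ^+ e and q >= 2. *)
pose K : R := C%:R * q%:R * lM * 2 / ln (m 1)%:R.
have := @tannery_geometric R (fun n e => B e n / n%:R / ln (m 1)%:R) block_rate
  (fun n => mean_info (q := q) mu Omega n / n%:R / ln (m 1)%:R) K (3 / 4).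
case.
- by apply/andP; split; lra.
- by rewrite /K !mulr_ge0 // ?invr_ge0 ltW.
- move=> n [|e].
    by rewrite block_entropy0 !mul0r lexx mulr_ge0 ?exprn_ge0 // ?divr_ge0;
      rewrite ?mulr_ge0 // ltW.
  have /andP[b0 bb] := block_entropy_bound d_ge2 q_gt1 m_step md_ge2
    closed_Omega mu_Omega (ltn0Sn e) n.
  have Nn : (Lcomp R m d n)%:R / n%:R <= C%:R :> R.
    have [->|n0] := posnP n; first by rewrite invr0 mulr0.
    by rewrite ler_pdivrMr ?ltr0n // -natrM ler_nat.
  apply/andP; split; first by rewrite !divr_ge0 // ltW.
  rewrite ler_pdivrMr //.
  apply: (@le_trans _ _ (C%:R / q%:R ^+ e * (e.+1%:R * lM))).
    apply: (@le_trans _ _ ((Lcomp R m d n)%:R / q%:R ^+ e * (e.+1%:R * lM) / n%:R)).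
      by rewrite ler_wpM2r ?invr_ge0.
    rewrite mulrAC [_ / _ / n%:R]mulrAC; apply: ler_wpM2r; first exact: mulr_ge0.
    by apply: ler_wpM2r => //; rewrite invr_ge0 exprn_ge0 // ltW.
  have -> : K * (3 / 4) ^+ e.+1 * ln (m 1)%:R =
      C%:R * q%:R * lM * (2 * (3 / 4) ^+ e.+1).
    by rewrite /K; field; rewrite gt_eqF.
  have -> : C%:R / q%:R ^+ e * (e.+1%:R * lM) =
      C%:R * q%:R * lM * (e.+1%:R / q%:R ^+ e.+1).
    by rewrite [_ ^+ e.+1]exprS; field; rewrite !gt_eqF ?exprn_gt0.
  rewrite ler_wpM2l ?mulr_ge0 // ?(ltW q0) //.
  rewrite ler_pdivrMr ?exprn_gt0 //.
  apply: le_trans (le_pow_three_halves _) _.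
  rewrite -mulrA ler_wpM2l // -exprMn lerXn2r ?nnegrE ?mulr_ge0 ?(ltW q0) //; try lra.
  have : 2 <= q%:R :> R by rewrite ler_nat.
  by lra.
- move=> [|e] /=.
    rewrite (_ : (fun n => _) = fun=> 0); first exact: cvg_cst.
    by apply/funext => n; rewrite block_entropy0 !mul0r.
  have h := rate_block_entropy d_ge2 q_gt1 m_step md_ge2 hp hsigma
    (first_coordinate_range e.+1) (ltn0Sn e) (@first_coordinateP e.+1)
    closed_Omega mu_Omega Omega_neq0.
  set H := Htilde _ _ _ _ _ _ _.
  rewrite (_ : H = ln (m 1)%:R * H / ln (m 1)%:R).
    by apply: cvgM; [exact: h|exact: cvg_cst].
  by rewrite mulrAC divff ?mul1r // gt_eqF.
- move=> n; exists (lev q (Lcomp R m d n) 1).+1 => M lM'.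
  by rewrite (mean_info_blocks lM') !mulr_suml.
move=> D serD meanD; exists D => //.
rewrite (_ : (fun n => _) = fun n => ln (m 1)%:R *
  (mean_info (q := q) mu Omega n / n%:R / ln (m 1)%:R)); last first.
  by apply/funext => n; rewrite mulrCA divff ?mulr1 // gt_eqF.
by apply: cvgM => //; exact: cvg_cst.
Qed.

Lemma block_rate_row s e : (1 <= s <= d)%N -> (0 < e)%N ->
  ((s < d)%N -> (p s < e)%N) -> ((1 < s)%N -> (e <= p s.-1)%N) ->
  block_rate e = Htilde q Omega mu p sigma s e.
Proof.
move=> sd e0 lo hi.
case: e e0 lo hi => // e _ lo hi; rewrite /block_rate.
rewrite (@first_coordinate_unique e.+1 s) // => k kd.
have anti := p_anti d_ge2 q_gt1 m_step md_ge2 hp.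
have [sk|ks] := leqP s k.
  by apply/esym; apply: leq_ltn_trans (lo _); [apply: anti; lia|lia].
apply/esym/negbTE; rewrite -leqNgt; apply: leq_trans (hi _) _; first by lia.
by apply: anti; lia.
Qed.

Lemma sum_block_rate_rows j : (1 <= j <= d.-1)%N ->
  \sum_(0 <= e < (p j).+1) block_rate e =
  \sum_(1 <= e < (p d.-1).+1) Htilde q Omega mu p sigma d e +
  \sum_(j.+1 <= s < d) \sum_((p s).+1 <= e < (p s.-1).+1)
     Htilde q Omega mu p sigma s e.
Proof.
have anti := p_anti d_ge2 q_gt1 m_step md_ge2 hp.
move=> jd; have [i jE] : exists i, j = (d.-1 - i)%N by exists (d.-1 - j)%N; lia.
elim: i j jd jE => [|i IH] j jd jE.
  rewrite (_ : j = d.-1) ?subn0; last by lia.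
  rewrite [X in _ + X]big_geq ?addr0; last by lia.
  rewrite big_ltn // /block_rate add0r; apply: eq_big_nat => e ed.
  by apply: block_rate_row => /=; lia.
have pp : (p j.+1 <= p j)%N by apply: anti; lia.
rewrite (big_cat_nat (n := (p j.+1).+1)) //=.
rewrite (IH j.+1); [|lia|lia].
rewrite -addrA; congr (_ + _).
rewrite [RHS]big_ltn; last by lia.
rewrite addrC /=; congr (_ + _); apply: eq_big_nat => e ed.
by apply: block_rate_row => /=; lia.
Qed.

(** For p s < e <= p s.-1 the group e is governed by the row s, which yields
    the three sums. *)
Lemma dimension_formulaE (D : R) : series block_rate @ \oo --> D ->
  D%:E = dimension_formula q Omega mu p sigma.
Proof.
move=> serD; rewrite /dimension_formula.
set X := \sum_(1 <= e < _) _; set Y := \sum_(2 <= s < d) _.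
have head : \sum_(0 <= e < (p 1).+1) block_rate e = X + Y.
  by rewrite sum_block_rate_rows //; lia.
rewrite (_ : \big[_/_]_((p 1).+1 <= e <oo) _ = (D - (X + Y))%:E).
  by rewrite -!EFinD; congr EFin; ring.
apply: cvg_lim => //.
rewrite (_ : (fun n => _) =
  fun n => (\sum_((p 1).+1 <= e < n) Htilde q Omega mu p sigma 1 e)%:E); last first.
  by apply/funext => n; rewrite sumEFin.
apply/cvg_EFin; first by apply: nearW.
have lim : (fun n => series block_rate n - (X + Y)) @ \oo --> D - (X + Y).
  by apply: cvgB => //; exact: cvg_cst.
apply: cvg_trans lim; apply: near_eq_cvg; near=> n.
have pn : ((p 1).+1 <= n)%N by near: n; exact: nbhs_infty_ge.
rewrite /= /series /= (big_cat_nat (leq0n _) pn) //= head addrAC subrr add0r.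
by apply: eq_big_nat => e en; rewrite (@block_rate_row 1) //=; lia.
Unshelve. all: by end_near. Qed.

End Assembly.

Theorem theorem3p1 (R : realType) (d q : nat) (m : nat -> nat)
    (hd : (2 <= d)%N) (hq : (2 <= q)%N)
    (hm : forall k, (1 <= k < d)%N -> (m k.+1 <= m k)%N) (hmd : (2 <= m d)%N)
    (p : nat -> nat) (hp : is_exponents R d q m p)
    (sigma : nat -> nat -> nat) (hsigma : is_sorting R d q m p sigma)
    (Omega : set (Sigma d m)) (hOmega0 : Omega !=set0) (hOmega : closed Omega)
    (mu : probability (Sigma d m) R) (hmu : mu Omega = 1%E)
    (Pmu : probability (Sigma d m) R) (hPmu : is_telescopic_product q mu Pmu) :
  exists2 D : R, exact_dimensional Pmu D
               & D%:E = dimension_formula q Omega mu p sigma.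
Proof.
have [D serD meanD] :=
  mean_info_rate hd hq hm hmd hp hsigma hOmega hmu hOmega0.
exists D; last exact: dimension_formulaE serD.
have lm1 : 0 < ln (m 1)%:R :> R by apply: (ln_m_gt0 hd hm hmd); lia.
have := info_cvg_ae hd hq hm hmd hPmu hOmega hmu meanD.
rewrite /exact_dimensional; apply: filterS => x [nz infoD].
have -> : D%:E = (ln (m 1)%:R * D / ln (m 1)%:R)%:E.
  by congr EFin; rewrite mulrAC divff ?mul1r // gt_eqF.
rewrite (_ : (fun n => _) = fun n => (info Pmu n x / n%:R / ln (m 1)%:R)%:E).
  by apply/cvg_EFin; [exact: nearW|apply: cvgM => //; exact: cvg_cst].
apply/funext => n; have mB := measurable_Ball (R := R) n x.
rewrite -[Pmu _]fineK ?fin_num_measure // lne_EFin; last first.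
  by rewrite lt0r nz fine_ge0.
by rewrite -!EFinM -EFinN /info; congr EFin; ring.
Qed.
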